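(* Let $d \geq 2$ be an integer and let $E \subset M_d^{0}(\mathbb{Z})$ satisfy $\overline{d}(E) > 0$. Then there exists an integer $k \geq 1$ such that for every $A \in k \cdot M_d^0(\mathbb{Z})$ there exists $g \in \operatorname{SL}_d(\mathbb{Z})$ with \[ \overline{d}\big(E \cap (E - gAg^{-1})\big) > 0, \] where $E - B = \{x - B : x \in E\}$ for a matrix $B$.
   Context: $M_d^0(\mathbb{Z})$ denotes the additive group of $d\times d$ integer matrices with trace zero, and $k\cdot M_d^0(\mathbb{Z})$ the set of such matrices all of whose entries are divisible by $k$. For $n \ge 1$ let $F_n = \{A=(a_{ij}) \in M_d^0(\mathbb{Z}) : |a_{ij}| \le n \text{ for all } (i,j) \neq (d,d)\}$. For $E \subset M_d^0(\mathbb{Z})$, its upper asymptotic density is $\overline{d}(E) = \limsup_{n\to\infty} |E \cap F_n|/|F_n|$. *)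

(* Defs.v *)
From HB Require Import structures.
From mathcomp Require Import all_boot all_order all_algebra.
From mathcomp Require Import all_classical all_reals all_analysis.
From mathcomp Require Import Rstruct Rstruct_topology finmap.

Set Implicit Arguments. Unset Strict Implicit. Unset Printing Implicit Defensive.
Import Order.TTheory GRing.Theory Num.Theory.
Local Open Scope classical_set_scope.
Local Open Scope ring_scope.

Definition Md0 (d : nat) : set 'M[int]_d := [set A | \tr A = 0].

Definition kMd0 (d k : nat) : set 'M[int]_d :=
  [set A | \tr A = 0 /\ forall i j, (k%:Z %| A i j)%Z].

(* F_n: trace-zero matrices with |a_ij| <= n for all (i,j) <> (d,d);
   the entry (d,d) is the one with row and column index d-1 (0-based). *)
Definition Fn (d n : nat) : set 'M[int]_d :=
  [set A | \tr A = 0 /\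
     forall i j : 'I_d, ~ ((i : nat) = d.-1 /\ (j : nat) = d.-1) ->
       `|A i j| <= n%:Z].

Arguments Md0 : clear implicits.
Arguments kMd0 : clear implicits.
Arguments Fn : clear implicits.

Definition dens_ratio (d : nat) (E : set 'M[int]_d) (n : nat) : Rdefinitions.R :=
  ((#|` fset_set (E `&` Fn d n)|)%fset%:R / (#|` fset_set (Fn d n)|)%fset%:R)%R.

Definition upper_density (d : nat) (E : set 'M[int]_d) : \bar Rdefinitions.R :=
  limn_esup (fun n => (dens_ratio E n)%:E).

Definition set_subm (d : nat) (E : set 'M[int]_d) (B : 'M[int]_d) : set 'M[int]_d :=
  [set x - B | x in E].

(* Main.v *)
Require Import Defs.
From HB Require Import structures.
From mathcomp Require Import all_boot all_order all_algebra.
From mathcomp Require Import all_classical all_reals all_analysis.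
From mathcomp Require Import Rstruct Rstruct_topology.
From mathcomp Require Import complex finmap separable cyclic cyclotomic zify ring lra.
Import Order.TTheory GRing.Theory Num.Theory.
Local Open Scope classical_set_scope.
Local Open Scope ring_scope.

Set Implicit Arguments. Unset Strict Implicit. Unset Printing Implicit Defensive.

(**
For a unitary character chi of the group of integer matrices let F(K, L)(chi)
be the Fejer kernel of side L on the lattice of trace-zero matrices divisible
by K: it is close to 1 when chi is nearly trivial on that lattice and close to
0 otherwise.

Let A <> 0 be trace-zero and divisible by k. The matrices v_s = u_s w_s^T, with
u_s and w_s polynomial in s and w_s u_s = 0, are nilpotent of rank one, so
conjugating A by I + 2 t v_s gives A + 2 t [v_s, A] - 4 t^2 tr(A v_s) v_s. By
van der Corput's inequality the average over t of chi at this quadratic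
polynomial is small unless chi is nearly trivial on a multiple of v_s; if this
fails for many s, then, since any sufficiently many v_s span a lattice of
finite index (Vandermonde), chi is nearly trivial on K M_d^0(Z) for some
multiple K of k depending only on A and e. On the other hand every conjugate of A lies
in k M_d^0(Z). Averaging over s and t thus gives a probability nu on the
conjugacy class of A with, for all chi,
  Re nu^(chi) + 4 e + F(K, L)(chi) - 2 F(k, L')(chi) >= 0.

Finite Fourier analysis on E cap F_n turns this into an inequality between
correlation densities. If all the return sets E cap (E - B), B in the class of
A, have density zero, the correlation of E along F(K, L) is at least twice the
one along F(k, L'), up to an error O(e). Were this the case for every k,
iterating would make a correlation exceed 1, since the first one is bounded below
in terms of the density of E.
*)

(** * Complex modulus, and a van der Corput bound for quadratic exponential sums *)

Section ComplexModulus.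
Variable R : realType.
Implicit Types (x y z : R[i]) (a : R).

Definition cabs z : R := ComplexField.Normc.normc z.
Definition cRe z : R := complex.Re z.

Lemma cabs_ge0 z : 0 <= cabs z.
Proof. by case: z => a b; rewrite /cabs /= sqrtr_ge0. Qed.

Lemma cabsM x y : cabs (x * y) = cabs x * cabs y.
Proof. exact: ComplexField.Normc.normcM. Qed.

Lemma cabsD x y : cabs (x + y) <= cabs x + cabs y.
Proof. exact: (@le_normcD R). Qed.

Lemma cabsN x : cabs (- x) = cabs x.
Proof. exact: (@normcN R). Qed.

Lemma cabs0 : cabs 0 = 0.
Proof. exact: ComplexField.Normc.normc0. Qed.

Lemma cabs1 : cabs 1 = 1.
Proof. exact: ComplexField.Normc.normc1. Qed.

Lemma cabsX z n : cabs (z ^+ n) = cabs z ^+ n.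
Proof. by elim: n => [|n IHn]; rewrite ?cabs1 // !exprS cabsM IHn. Qed.

Lemma cabs1_neq0 z : cabs z = 1 -> z != 0.
Proof.
by move=> z1; apply/eqP => E; move: z1; rewrite E cabs0 => /eqP; rewrite eq_sym oner_eq0.
Qed.

Lemma cabs_real a : cabs a%:C%C = `|a|.
Proof. by rewrite /cabs /= expr0n /= addr0 sqrtr_sqr. Qed.

Lemma cabs_nat n : cabs n%:R = n%:R.
Proof. by rewrite -(rmorph_nat (real_complex R)) cabs_real normr_nat. Qed.

Lemma cabs_conj z : cabs (conjc z) = cabs z.
Proof. by case: z => a b; rewrite /cabs /= sqrrN. Qed.

Lemma cabs_sum (I : Type) (s : seq I) (P : pred I) (F : I -> R[i]) :
  cabs (\sum_(i <- s | P i) F i) <= \sum_(i <- s | P i) cabs (F i).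
Proof.
elim/big_rec2: _ => [|i y1 y2 _ IH]; first by rewrite cabs0.
by rewrite (le_trans (cabsD _ _)) // lerD2l.
Qed.

Lemma cabsV z : cabs z^-1 = (cabs z)^-1.
Proof. exact: ComplexField.Normc.normcV. Qed.

Lemma mul_conj z : z * conjc z = (cabs z ^+ 2)%:C%C.
Proof. by rewrite -sqr_normc rmorphXn. Qed.

Lemma mul_conj1 z : cabs z = 1 -> z * conjc z = 1.
Proof. by rewrite mul_conj => ->; rewrite expr1n. Qed.

Lemma cReD x y : cRe (x + y) = cRe x + cRe y.
Proof. by case: x y => [a b] [c e]. Qed.

Lemma cRe_sum (I : Type) (s : seq I) (P : pred I) (F : I -> R[i]) :
  cRe (\sum_(i <- s | P i) F i) = \sum_(i <- s | P i) cRe (F i).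
Proof. by rewrite (big_morph cRe cReD (erefl : cRe 0 = 0)). Qed.

Lemma cRe_real a : cRe a%:C%C = a.
Proof. by []. Qed.

Lemma cReMl a z : cRe (a%:C%C * z) = a * cRe z.
Proof. by case: z => b c; rewrite /cRe /= mul0r subr0. Qed.

Lemma cReMr a z : cRe (z * a%:C%C) = cRe z * a.
Proof. by rewrite mulrC cReMl mulrC. Qed.

Lemma cRe_le z : `|cRe z| <= cabs z.
Proof.
case: z => a b; rewrite /cRe /cabs /= -sqrtr_sqr ler_wsqrtr // lerDl.
exact: sqr_ge0.
Qed.

Lemma cRe_ge z : - cabs z <= cRe z.
Proof. by have := cRe_le z; rewrite ler_norml => /andP[]. Qed.

Lemma cRe_lecabs z : cRe z <= cabs z.
Proof. by have := cRe_le z; rewrite ler_norml => /andP[]. Qed.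

Lemma cabs_sumM1 z n : cabs z = 1 ->
  cabs (\sum_(i < n) z ^+ i) * cabs (z - 1) <= 2.
Proof.
move=> z1; rewrite mulrC -cabsM -subrX1.
by rewrite (le_trans (cabsD _ _)) // cabsN cabs1 cabsX z1 expr1n.
Qed.

Lemma cabsM_sub1 x y : cabs x = 1 ->
  cabs (x * y - 1) <= cabs (x - 1) + cabs (y - 1).
Proof.
move=> x1; have -> : x * y - 1 = x * (y - 1) + (x - 1) by ring.
by rewrite (le_trans (cabsD _ _)) // cabsM x1 mul1r addrC.
Qed.

Lemma cabsX_sub1 z n : cabs z = 1 -> cabs (z ^+ n - 1) <= n%:R * cabs (z - 1).
Proof.
move=> z1; elim: n => [|n IHn]; first by rewrite subrr cabs0 mul0r.
rewrite exprS (le_trans (cabsM_sub1 _ z1)) // -natr1 mulrDl mul1r addrC.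
by rewrite lerD2r.
Qed.

Lemma sqr_sum_le (n : nat) (F : 'I_n -> R) :
  (\sum_i F i) ^+ 2 <= n%:R * \sum_i F i ^+ 2.
Proof.
have -> : (\sum_i F i) ^+ 2 = \sum_i \sum_j F i * F j.
  by rewrite expr2 mulr_suml; apply: eq_bigr => i _; rewrite mulr_sumr.
have -> : n%:R * \sum_i F i ^+ 2 = \sum_i \sum_j (F i ^+ 2 + F j ^+ 2) / 2.
  under [RHS]eq_bigr => i _ do
    rewrite -mulr_suml big_split /= sumr_const card_ord.
  rewrite -mulr_suml big_split /= sumrMnl sumr_const card_ord -mulr_natl.
  by field.
apply: ler_sum => i _; apply: ler_sum => j _.
have := sqr_ge0 (F i - F j); rewrite sqrrB; lra.
Qed.

Lemma cabs_sum_sqr_le (n : nat) (F : 'I_n -> R[i]) :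
  cabs (\sum_i F i) ^+ 2 <= n%:R * \sum_i cabs (F i) ^+ 2.
Proof.
apply: le_trans (sqr_sum_le _); rewrite lerXn2r ?nnegrE ?cabs_ge0 //.
  by apply: sumr_ge0 => i _; apply: cabs_ge0.
exact: cabs_sum.
Qed.

(* van der Corput differencing: correlating the phase with its shift by [m]
   leaves the geometric progression of ratio [al ^+ (2 * m)]. *)
Lemma quadratic_phase_corr (al be : R[i]) (T h m : nat) :
  cabs al = 1 -> cabs be = 1 ->
  let x t := be ^+ t * al ^+ (t ^ 2) in
  cabs (\sum_(s < T) x (s + (h + m))%N * conjc (x (s + h)%N)) =
  cabs (\sum_(s < T) (al ^+ (2 * m)) ^+ s).
Proof.
move=> al1 be1 x; have x1 t : cabs (x t) = 1.
  by rewrite cabsM !cabsX al1 be1 !expr1n mulr1.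
pose c := be ^+ m * al ^+ (m * (2 * h + m)).
have -> : \sum_(s < T) x (s + (h + m))%N * conjc (x (s + h)%N) =
          c * \sum_(s < T) (al ^+ (2 * m)) ^+ s.
  rewrite mulr_sumr; apply: eq_bigr => s _.
  have -> : x (s + (h + m))%N = x (s + h)%N * (c * (al ^+ (2 * m)) ^+ s).
    rewrite /x /c.
    have -> : (s + (h + m) = (s + h) + m)%N by lia.
    have -> : (((s + h) + m) ^ 2 =
        (s + h) ^ 2 + (m * (2 * h + m) + 2 * m * s))%N.
      by rewrite !expnS !expn0; lia.
    rewrite -[(al ^+ (2 * m)) ^+ s]exprM (exprD be (s + h)).
    rewrite (exprD al ((s + h) ^ 2)) (exprD al (m * (2 * h + m))).
    by rewrite mulrACA !mulrA.
  by rewrite mulrAC mul_conj1 // mul1r.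
by rewrite cabsM /c cabsM !cabsX al1 be1 !expr1n !mul1r.
Qed.

(** Cauchy-Schwarz over [s], then the square is expanded into correlations of two shifts. Each
    diagonal correlation is at most [T]. Off the diagonal the geometric ratio is [al ^+ (2 * m)]
    with [0 < m < H]; as [m] divides the factorial of [H], the hypothesis keeps this ratio away from
    1. Summing over windows [s + h] avoids boundary terms. *)
Lemma quadratic_phase_sum (al be : R[i]) (H T : nat) (eta : R) :
  cabs al = 1 -> cabs be = 1 -> 0 < eta ->
  eta <= cabs (al ^+ (2 * H`!) - 1) ->
  cabs (\sum_(s < T) \sum_(h < H) be ^+ (s + h) * al ^+ ((s + h) ^ 2)) ^+ 2 <=
  T%:R * (H%:R * T%:R + (H ^ 2)%:R * (2 * H`!%:R / eta)).
Proof.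
move=> al1 be1 eta0 Heta; pose x t := be ^+ t * al ^+ (t ^ 2).
have x1 t : cabs (x t) = 1 by rewrite cabsM !cabsX al1 be1 !expr1n mulr1.
apply: (le_trans (cabs_sum_sqr_le _)); rewrite ler_wpM2l //.
pose y (h k : 'I_H) := \sum_(s < T) x (s + h)%N * conjc (x (s + k)%N).
have -> : \sum_(s < T) cabs (\sum_(h < H) x (s + h)%N) ^+ 2 =
          cRe (\sum_h \sum_k y h k).
  rewrite /y; under [X in cRe X]eq_bigr => h _ do rewrite exchange_big /=.
  rewrite [X in cRe X]exchange_big /= cRe_sum; apply: eq_bigr => s _.
  rewrite -[LHS]cRe_real -mul_conj; congr cRe.
  rewrite rmorph_sum mulr_suml; apply: eq_bigr => h _.
  by rewrite mulr_sumr.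
apply: (le_trans (cRe_lecabs _)); apply: (le_trans (cabs_sum _ _ _)).
have bound_lt (h k : 'I_H) : (k < h)%N -> cabs (y h k) <= 2 * H`!%:R / eta.
  move=> lt_kh; rewrite /y; set m := (h - k)%N.
  have m_gt0 : (0 < m)%N by rewrite subn_gt0.
  have -> : h = (k + m)%N :> nat by rewrite /m; lia.
  rewrite quadratic_phase_corr //; set ga := al ^+ (2 * m).
  have ga1 : cabs ga = 1 by rewrite cabsX al1 expr1n.
  have dv : (m %| H`!)%N.
    by apply: dvdn_fact; rewrite m_gt0 /= /m; have := ltn_ord h; lia.
  have Eal : al ^+ (2 * H`!) = ga ^+ (H`! %/ m).
    by rewrite /ga -exprM -mulnA (mulnC m) divnK.
  have le_eta : eta <= H`!%:R * cabs (ga - 1).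
    rewrite (le_trans Heta) // Eal (le_trans (cabsX_sub1 _ ga1)) //.
    by rewrite ler_wpM2r ?cabs_ge0 // ler_nat leq_div.
  have ga_gt0 : 0 < cabs (ga - 1).
    rewrite lt_neqAle cabs_ge0 andbT; apply/eqP => E.
    by move: le_eta; rewrite -E mulr0 leNgt eta0.
  rewrite ler_pdivlMr //; have := cabs_sumM1 T ga1.
  set q := cabs (\sum_i _) => Hq; have q0 : 0 <= q by exact: cabs_ge0.
  apply: (le_trans (ler_wpM2l q0 le_eta)).
  by rewrite mulrCA mulrC ler_wpM2r.
have bound (h k : 'I_H) :
    cabs (y h k) <= (h == k)%:R * T%:R + 2 * H`!%:R / eta.
  have b0 : 0 <= 2 * H`!%:R / eta by rewrite divr_ge0 ?mulr_ge0 // ltW.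
  case: (ltngtP h k) => [lt_hk|lt_kh|/val_inj ->].
  - have -> : y h k = conjc (y k h).
      rewrite /y rmorph_sum; apply: eq_bigr => s _.
      by rewrite [RHS]rmorphM /= conjcK mulrC.
    by rewrite cabs_conj ler_wpDl ?mulr_ge0 // bound_lt.
  - by rewrite ler_wpDl ?mulr_ge0 // bound_lt.
  rewrite eqxx mul1r ler_wpDr // (le_trans (cabs_sum _ _ _)) //.
  rewrite -[X in _ <= X%:R]card_ord -sumr_const ler_sum // => s _.
  by rewrite cabsM cabs_conj !x1 mulr1.
apply: (@le_trans _ _ (\sum_(h < H) \sum_(k < H)
   ((h == k)%:R * T%:R + 2 * H`!%:R / eta))).
  apply: ler_sum => h _; apply: (le_trans (cabs_sum _ _ _)).
  by apply: ler_sum => k _.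
under eq_bigr => h _.
  rewrite big_split /= sumr_const card_ord (bigD1 h) //= eqxx mul1r big1 ?addr0.
    over.
  by move=> k /negPf; rewrite eq_sym => ->; rewrite mul0r.
rewrite sumr_const card_ord; set c := 2 * _ / eta.
rewrite -[leLHS]mulr_natl -[X in _ * (_ + X)]mulr_natl expnS expn1 natrM.
by rewrite mulrDr mulrA.
Qed.

End ComplexModulus.

(** * Unitary characters and Fejer kernels *)

Section UnitaryCharacters.
Variables (R : realType) (G : zmodType).
Implicit Types (x y b : G) (nu bs : seq G).

Definition unitary_char (chi : G -> R[i]) : Prop :=
  (forall x y, chi (x + y) = chi x * chi y) /\ (forall x, cabs (chi x) = 1).

Definition cdist (chi : G -> R[i]) x : R := cabs (chi x - 1).

(** Fourier transform at [chi] of the uniform probability on the list [nu], counted with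
    multiplicity. *)
Definition cavg nu (chi : G -> R[i]) : R[i] :=
  (\sum_(x <- nu) chi x) / (size nu)%:R.

(** Repetitions are kept, so that averages factor over the generators even when these are dependent
    or zero. *)
Fixpoint cube (L : nat) bs : seq G :=
  if bs is b :: bs' then [seq b *+ j + x | j <- iota 0 L, x <- cube L bs']
  else [:: 0].

(** The law of the difference of two independent points of the cube; its transform is a squared
    modulus, hence nonnegative. *)
Definition fejer L bs : seq G :=
  [seq x - y | x <- cube L bs, y <- cube L bs].

Section OneCharacter.
Variable chi : G -> R[i].
Hypothesis chiP : unitary_char chi.

Let chiD x y : chi (x + y) = chi x * chi y. Proof. by case: chiP => + _; apply. Qed.
Let chi1 x : cabs (chi x) = 1. Proof. by case: chiP => _; apply. Qed.

Lemma char_neq0 x : chi x != 0.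
Proof. exact: cabs1_neq0. Qed.

Lemma char0 : chi 0 = 1.
Proof. by apply: (mulfI (char_neq0 0)); rewrite -chiD addr0 mulr1. Qed.

Lemma charN x : chi (- x) = conjc (chi x).
Proof.
apply: (mulfI (char_neq0 x)).
by rewrite -chiD subrr char0 mul_conj1.
Qed.

Lemma charMn x n : chi (x *+ n) = chi x ^+ n.
Proof. by elim: n => [|n IHn]; rewrite ?mulr0n ?char0 // mulrS chiD IHn exprS. Qed.

Lemma cdist_ge0 x : 0 <= cdist chi x.
Proof. exact: cabs_ge0. Qed.

Lemma cdist0 : cdist chi 0 = 0.
Proof. by rewrite /cdist char0 subrr cabs0. Qed.

Lemma cdistD x y : cdist chi (x + y) <= cdist chi x + cdist chi y.
Proof. by rewrite /cdist chiD cabsM_sub1. Qed.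

Lemma cdistN x : cdist chi (- x) = cdist chi x.
Proof.
by rewrite /cdist charN -(cabs_conj (chi x - 1)) rmorphB rmorph1.
Qed.

Lemma cdistMn x n : cdist chi (x *+ n) <= n%:R * cdist chi x.
Proof. by rewrite /cdist charMn cabsX_sub1. Qed.

Lemma cdistMz x (m : int) : cdist chi (x *~ m) <= `|m|%:R * cdist chi x.
Proof.
case: m => n; first by rewrite -pmulrn absz_nat cdistMn.
by rewrite NegzE mulrNz cdistN -pmulrn abszN absz_nat cdistMn.
Qed.

Lemma cdist_sum (I : Type) (s : seq I) (P : pred I) (F : I -> G) :
  cdist chi (\sum_(i <- s | P i) F i) <= \sum_(i <- s | P i) cdist chi (F i).
Proof.
elim/big_rec2: _ => [|i y1 y2 _ IH]; first by rewrite cdist0.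
by rewrite (le_trans (cdistD _ _)) // lerD2l.
Qed.

Lemma cabs_cavg nu : cabs (cavg nu chi) <= 1.
Proof.
rewrite /cavg cabsM cabsV cabs_nat; case: nu => [|x nu].
  by rewrite big_nil cabs0 mul0r.
rewrite ler_pdivrMr ?ltr0n // mul1r (le_trans (cabs_sum _ _ _)) //.
by under eq_bigr do rewrite chi1; rewrite big_const_seq count_predT iter_addr_0.
Qed.

Lemma cavg_dist nu (e : R) : (0 < size nu)%N ->
  (forall x, x \in nu -> cdist chi x <= e) -> cabs (cavg nu chi - 1) <= e.
Proof.
move=> nu0 He; have n0 : (size nu)%:R != 0 :> R[i] by rewrite pnatr_eq0 -lt0n.
have -> : cavg nu chi - 1 = (\sum_(x <- nu) (chi x - 1)) / (size nu)%:R.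
  by rewrite sumrB big_const_seq count_predT iter_addr_0 mulrBl divff.
rewrite cabsM cabsV cabs_nat ler_pdivrMr ?ltr0n //.
rewrite (le_trans (cabs_sum _ _ _)) //.
apply: (@le_trans _ _ (\sum_(x <- nu) e)).
  by rewrite big_seq [leRHS]big_seq ler_sum.
by rewrite big_const_seq count_predT iter_addr_0 mulr_natr.
Qed.

Lemma size_cube L bs : size (cube L bs) = (L ^ size bs)%N.
Proof. by elim: bs => //= b bs IH; rewrite size_allpairs size_iota IH expnS. Qed.

Lemma size_fejer L bs : size (fejer L bs) = ((L ^ size bs) ^ 2)%N.
Proof. by rewrite size_allpairs size_cube expnS expn1. Qed.

Lemma cavg_cube_cons L b bs :
  cavg (cube L (b :: bs)) chi =
  (\sum_(j < L) chi b ^+ j) / L%:R * cavg (cube L bs) chi.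
Proof.
rewrite /cavg /= big_allpairs_dep size_allpairs size_iota /=.
rewrite natrM invfM [RHS]mulrACA; congr (_ * _); rewrite mulr_suml.
rewrite -(big_mkord xpredT (fun j => chi b ^+ j * _)) /index_iota subn0.
apply: eq_bigr => j _; rewrite mulr_sumr; apply: eq_bigr => x _.
by rewrite chiD charMn.
Qed.

Lemma cavg_fejer L bs :
  cavg (fejer L bs) chi = (cabs (cavg (cube L bs) chi) ^+ 2)%:C%C.
Proof.
rewrite -mul_conj /cavg big_allpairs_dep size_allpairs /=.
rewrite [X in _ = _ * X]rmorphM /= conjc_inv conjc_nat natrM invfM mulrACA; congr (_ * _).
rewrite rmorph_sum mulr_suml; apply: eq_bigr => x _.
by rewrite mulr_sumr; apply: eq_bigr => y _; rewrite chiD charN.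
Qed.

Lemma cRe_fejer L bs :
  cRe (cavg (fejer L bs) chi) = cabs (cavg (cube L bs) chi) ^+ 2.
Proof. by rewrite cavg_fejer. Qed.

Lemma fejer_ge0 L bs : 0 <= cRe (cavg (fejer L bs) chi).
Proof. by rewrite cRe_fejer sqr_ge0. Qed.

Lemma fejer_le1 L bs : cRe (cavg (fejer L bs) chi) <= 1.
Proof. by rewrite (le_trans (cRe_lecabs _)) // cabs_cavg. Qed.

Lemma cdist_cube L bs (rho : R) x : 0 <= rho ->
  (forall b, b \in bs -> cdist chi b <= rho) -> x \in cube L bs ->
  cdist chi x <= (size bs * L)%:R * rho.
Proof.
move=> rho0; elim: bs x => [|b bs IH] x Hb /=.
  by rewrite inE => /eqP ->; rewrite cdist0 mul0r.
case/allpairsP => -[j y] /= [+ Hy ->]; rewrite mem_iota add0n /= => lt_jL.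
rewrite (le_trans (cdistD _ _)) // mulSn natrD mulrDl lerD //.
  rewrite (le_trans (cdistMn _ _)) // ler_pM ?cdist_ge0 ?ler_nat ?(ltnW lt_jL) //.
  by rewrite Hb ?mem_head.
by apply: IH => // c Hc; rewrite Hb // inE Hc orbT.
Qed.

Lemma fejer_near L bs (rho : R) : (0 < L)%N -> 0 <= rho ->
  (forall b, b \in bs -> cdist chi b <= rho) ->
  1 - 2 * ((size bs * L)%:R * rho) <= cRe (cavg (fejer L bs) chi).
Proof.
move=> L0 rho0 Hb; rewrite cRe_fejer.
have := @cavg_dist (cube L bs) ((size bs * L)%:R * rho).
rewrite size_cube expn_gt0 L0 => /(_ isT) H.
have {H}/= := H (fun x => cdist_cube rho0 Hb).
set z := cavg _ _; set q := _ * rho => Hz.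
have h1 : 1 <= cabs z + cabs (z - 1).
  rewrite -{1}cabs1 -[X in cabs X <= _](subKr z) (le_trans (cabsD _ _)) //.
  by rewrite cabsN.
have := cabs_ge0 (z - 1); have := sqr_ge0 (1 - cabs z); rewrite sqrrB; lra.
Qed.

(** The transform of the cube is a product over the generators. The factor of [b] is a normalized
    geometric sum, at most [2 / (L * eta)]; the other factors are at most 1. *)
Lemma fejer_far L bs b (eta : R) : (0 < L)%N -> 0 < eta ->
  b \in bs -> eta < cdist chi b ->
  cRe (cavg (fejer L bs) chi) <= (2 / (L%:R * eta)) ^+ 2.
Proof.
move=> L0 eta0 b_bs Hb; rewrite cRe_fejer.
have Le0 : 0 < L%:R * eta by rewrite mulr_gt0 ?ltr0n.
rewrite lerXn2r ?nnegrE ?cabs_ge0 //; first by rewrite divr_ge0 // ltW.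
elim: bs b_bs => // c bs IH; rewrite inE cavg_cube_cons cabsM.
case/orP => [/eqP <-|/IH{IH}IH].
  rewrite -[leRHS]mulr1 ler_pM ?cabs_ge0 ?cabs_cavg //.
  rewrite cabsM cabsV cabs_nat invfM mulrA [leRHS]mulrAC ler_wpM2r ?invr_ge0 //.
  rewrite ler_pdivlMr // (le_trans _ (cabs_sumM1 L (chi1 b))) //.
  by rewrite ler_wpM2l ?cabs_ge0 // ltW.
rewrite -[leRHS]mul1r ler_pM ?cabs_ge0 //.
rewrite cabsM cabsV cabs_nat ler_pdivrMr ?ltr0n // mul1r.
rewrite (le_trans (cabs_sum _ _ _)) //.
under eq_bigr => j _ do rewrite cabsX chi1 expr1n.
by rewrite sumr_const card_ord.
Qed.

End OneCharacter.
End UnitaryCharacters.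

Lemma mulrz_scalemx p q (A : 'M[int]_(p, q)) (z : int) : A *~ z = z *: A.
Proof. by rewrite -scaler_int intz. Qed.

(** * A polynomial curve of nilpotent matrices of rank one *)

Section NilpotentCurve.
Variable n : nat.
Local Notation Mat := 'M[int]_n.+1.
Implicit Types (s t l : nat) (i j : 'I_n.+1).

Local Notation D := (2 * n.+1)%N.
Definition curve_len : nat := (D * n.+1)%N.

Definition curve_u s : 'cV[int]_n.+1 := \col_i (s%:Z ^+ i).
(** Entry 0 is chosen so that [curve_w s *m curve_u s] vanishes, since [curve_u s] starts with 1.
    Exponents in [curve s] are read in base [D]: the high digit is [j] or [k], and the low digit, an
    index or a sum of two, is at most [2 * n], so monomials can be told apart. *)
Definition curve_w s : 'rV[int]_n.+1 :=
  \row_j (if j == ord0 then - \sum_(k < n.+1 | k != ord0) s%:Z ^+ (k + D * k)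
          else s%:Z ^+ (D * j)).
Definition curve s : Mat := curve_u s *m curve_w s.

(** The matrix coefficient of [s ^ l] in the expansion of [curve s]. *)
Definition curve_coef l : Mat :=
  \matrix_(i, j) (if j == ord0
    then - \sum_(k < n.+1 | k != ord0) (l == i + (k + D * k))%N%:R
    else (l == i + D * j)%N%:R).

(* [tzbase ord0 ord0] is 0; the others form a basis of the trace-zero matrices. *)
Definition tzbase i j : Mat := delta_mx i j - (i == j)%:R *: delta_mx ord0 ord0.

Lemma digits_eq (a a' k k' : nat) : (a < D)%N -> (a' < D)%N ->
  (a + D * k == a' + D * k')%N = (a == a') && (k == k').
Proof.
move=> ltaD lta'D; apply/eqP/andP => [E|[/eqP -> /eqP ->]] //.
have Dgt0 : (0 < D)%N by [].
have Em b q : (b < D)%N -> ((b + D * q) %% D)%N = b.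
  by move=> ltb; rewrite (mulnC D) addnC modnMDl modn_small.
have := congr1 (modn^~ D) E; rewrite !Em // => Ea; move: E; rewrite Ea eqxx => /addnI/eqP.
by rewrite eqn_pmul2l.
Qed.

Lemma exponent_lt i k : (k <= n)%N -> (i + (k + D * k) < curve_len)%N.
Proof. by move=> lekn; rewrite /curve_len; have := ltn_ord i; nia. Qed.

Lemma sum_pick (m e : nat) (x : nat -> int) : (e < m)%N ->
  \sum_(l < m) x l * (val l == e)%:R = x e.
Proof.
move=> lt_em; rewrite (bigD1 (Ordinal lt_em)) //= eqxx mulr1 big1 ?addr0 //.
by move=> l /negPf; rewrite -val_eqE /= => ->; rewrite mulr0.
Qed.

Lemma curveE s :
  curve s = \sum_(l < curve_len) curve_coef l *~ (s%:Z ^+ l).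
Proof.
apply/matrixP => i j; rewrite summxE.
under [RHS]eq_bigr => l _ do rewrite mulrz_scalemx !mxE.
rewrite !mxE big_ord1 !mxE; case: (j =P ord0) => [_|/eqP j0].
  under eq_bigr => l _ do rewrite mulrN mulr_sumr.
  rewrite sumrN exchange_big /= mulrN mulr_sumr; congr (- _).
  apply: eq_bigr => k _; rewrite sum_pick ?exprD //.
  by apply: exponent_lt; rewrite -ltnS.
rewrite sum_pick ?exprD //; apply: leq_ltn_trans (exponent_lt i (ltn_ord j)).
by rewrite leq_add2l leq_addl.
Qed.

Lemma curve_wu s : curve_w s *m curve_u s = 0.
Proof.
apply/matrixP => i j; rewrite !ord1 !mxE (bigD1 ord0) //= !mxE eqxx expr0 mulr1.
apply/eqP; rewrite addrC subr_eq0; apply/eqP; apply: eq_bigr => k /negPf k0.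
by rewrite !mxE k0 -exprD addnC.
Qed.

Lemma curve_sqr s : curve s *m curve s = 0.
Proof. by rewrite /curve mulmxA -(mulmxA _ (curve_w s)) curve_wu mulmx0 mul0mx. Qed.

(** With [v = u w] of rank one, [v A v = u (w A u) w], and the scalar [w A u] is the trace of
    [A v]. *)
Lemma curve_sandwich s (A : Mat) :
  curve s *m A *m curve s = curve s *~ \tr (A *m curve s).
Proof.
rewrite /curve [X in _ *~ X](_ : _ = (curve_w s *m A *m curve_u s) ord0 ord0).
  rewrite !mulmxA -(mulmxA _ (curve_w s)) -(mulmxA _ (curve_w s *m A)).
  rewrite [_ *m _ *m curve_u s]mx11_scalar mulrz_scalemx mul_mx_scalar -scalemxAl.
  by rewrite [(_%:M) _ _]mxE eqxx mulr1n.
by rewrite mulmxA mxtrace_mulC mulmxA trace_mx11.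
Qed.

(** For [i != ord0] the low digit [i + n] exceeds every row index, so this exponent occurs only in
    column 0, through the term [k = n]. *)
Lemma curve_coef_col0 i : i != ord0 ->
  curve_coef (i + n + D * n) = - delta_mx i ord0.
Proof.
move=> i0; apply/matrixP => a b; rewrite !mxE; have i_gt0 : (0 < i)%N by rewrite lt0n.
have lti := ltn_ord i; have lta := ltn_ord a.
case: (b =P ord0) => [_|/eqP /negPf b0].
  congr (- _); rewrite andbT (bigD1 ord_max) /=; last first.
    by rewrite -val_eqE /= ; lia.
  rewrite addnA digits_eq ?eqxx ?andbT; try lia.
  rewrite eqn_add2r eq_sym -val_eqE big1 ?addr0 // => k /andP[_ kn].
  rewrite addnA digits_eq; try by have := ltn_ord k; lia.
  by rewrite (_ : (n == k) = false) ?andbF // eq_sym; exact/negbTE.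
rewrite digits_eq; try by lia.
Qed.

Lemma curve_coef_pos i j : j != ord0 ->
  curve_coef (i + D * j) =
  delta_mx i j - (if (j <= i)%N then delta_mx (inord (i - j)) ord0 else 0).
Proof.
move=> j0; apply/matrixP => a b; rewrite !mxE.
have lti := ltn_ord i; have lta := ltn_ord a; have ltj := ltn_ord j.
case: (b =P ord0) => [->|/eqP /negPf b0].
  rewrite [ord0 == j]eq_sym (negPf j0) andbF add0r; congr (- _).
  rewrite (bigD1 j) //= addnA digits_eq ?eqxx ?andbT; try lia.
  rewrite big1 ?addr0; last first.
    move=> k /andP[_ kj]; rewrite addnA digits_eq; try by have := ltn_ord k; lia.
    by rewrite [X in _ && X](_ : _ = false) ?andbF // eq_sym; exact/negbTE.
  case: leqP => [leji|ltij]; last by rewrite mxE (_ : (i == a + j :> nat)%N = false) //; lia.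
  rewrite mxE andbT -val_eqE /= inordK; last by lia.
  by congr (nat_of_bool _)%:R; lia.
rewrite digits_eq; try by lia.
rewrite [X in _ = _ - X](_ : _ = 0) ?subr0; last first.
  by case: ifP => _; rewrite mxE ?b0 ?andbF.
by rewrite -!val_eqE /= [(i : nat) == a]eq_sym [(j : nat) == b]eq_sym.
Qed.

(** For [j != ord0], the coefficient at [i + D * j] is the elementary matrix at [(i, j)] minus a
    possible residue in column 0, at row [i - j]. On the diagonal this residue is the one in
    [tzbase i i]; for [j < i] it is cancelled by a coefficient from [curve_coef_col0]. *)
Lemma tzbase_coef i j : (0 < n)%N ->
  exists l1 l2 : 'I_curve_len, exists a1 a2 : int,
    [/\ (`|a1| <= 1)%N, (`|a2| <= 1)%N &
       tzbase i j = curve_coef l1 *~ a1 + curve_coef l2 *~ a2].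
Proof.
move=> n0; have lti := ltn_ord i; have ltj := ltn_ord j.
have lt1 (a b : nat) : (a < D)%N -> (b <= n)%N -> (a + D * b < curve_len)%N.
  by rewrite /curve_len; nia.
have z0 : (0 < curve_len)%N by [].
have ltcol0 (k : 'I_n.+1) : (k + n + D * n < curve_len)%N.
  by apply: lt1 => //; have := ltn_ord k; lia.
case: (eqVneq j ord0) => [->|j0].
  case: (eqVneq i ord0) => [->|i0].
    exists (Ordinal z0), (Ordinal z0), 0, 0; split => //.
    by rewrite /tzbase eqxx scale1r subrr !mulr0z addr0.
  exists (Ordinal (ltcol0 i)), (Ordinal z0), (-1), 0; split => //.
  rewrite /= curve_coef_col0 // mulrNz mulr0z addr0 mulr1z opprK /tzbase.
  by rewrite (negPf i0) scale0r subr0.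
have ltp : (i + D * j < curve_len)%N by apply: lt1 => //; lia.
case: (ltngtP i j) => [ltij|ltji|/val_inj eij].
- exists (Ordinal ltp), (Ordinal z0), 1, 0; split => //.
  rewrite /= curve_coef_pos // leqNgt ltij /= subr0 mulr1z mulr0z addr0.
  by rewrite /tzbase -val_eqE /= (_ : (i == j :> nat) = false) ?scale0r ?subr0 //; lia.
- pose k : 'I_n.+1 := inord (i - j).
  have k0 : k != ord0 by rewrite -val_eqE /= inordK; lia.
  exists (Ordinal ltp), (Ordinal (ltcol0 k)), 1, (-1); split => //.
  rewrite /= curve_coef_pos // (ltnW ltji) curve_coef_col0 // mulrNz !mulr1z.
  rewrite opprK subrK /tzbase -val_eqE /= (_ : (i == j :> nat) = false); last by lia.
  by rewrite scale0r subr0.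
- exists (Ordinal ltp), (Ordinal z0), 1, 0; split => //.
  rewrite /= curve_coef_pos // -eij leqnn subnn mulr1z mulr0z addr0.
  by rewrite /tzbase eqxx scale1r; congr (_ - delta_mx _ _); apply/val_inj; rewrite /= inordK.
Qed.

Lemma trace0_decomp (A : Mat) : \tr A = 0 ->
  A = \sum_i \sum_j tzbase i j *~ A i j.
Proof.
move=> trA; rewrite {1}[A]matrix_sum_delta.
have -> : \sum_i \sum_j tzbase i j *~ A i j =
   \sum_i \sum_j A i j *: delta_mx i j - \sum_i \sum_j (A i j * (i == j)%:R) *: delta_mx ord0 ord0.
  rewrite -sumrB; apply: eq_bigr => i _; rewrite -sumrB; apply: eq_bigr => j _.
  by rewrite mulrz_scalemx scalerBr scalerA.
suff -> : \sum_i \sum_j (A i j * (i == j)%:R) *: delta_mx ord0 ord0 = 0 :> Mat.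
  by rewrite subr0.
under eq_bigr => i _.
  rewrite (bigD1 i) //= eqxx mulr1 big1 ?addr0; first over.
  by move=> j /negPf; rewrite eq_sym => ->; rewrite mulr0 scale0r.
by rewrite -scaler_suml -/(\tr A) trA scale0r.
Qed.

(** Otherwise [A] is orthogonal to every [tzbase i j] for the trace form, hence scalar, and a scalar
    matrix of trace zero is 0. *)
Lemma curve_trace_neq0 (A : Mat) : (0 < n)%N -> \tr A = 0 -> A != 0 ->
  exists l : 'I_curve_len, \tr (A *m curve_coef l) != 0.
Proof.
move=> n0 trA; apply: contra_neqP => /forallNP noexists.
have coef0 (l : 'I_curve_len) : \tr (A *m curve_coef l) = 0.
  by apply/eqP; have := noexists l; case: eqP.
have base0 i j : \tr (A *m tzbase i j) = 0.
  have [l1 [l2 [a1 [a2 [_ _ ->]]]]] := tzbase_coef i j n0.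
  rewrite !mulrz_scalemx mulmxDr -!scalemxAr mxtraceD !mxtraceZ !coef0.
  by rewrite !mulr0 addr0.
have tr_delta i j : \tr (A *m delta_mx i j) = A j i.
  rewrite /mxtrace (bigD1 j) //= big1 ?addr0 => [|k kj]; rewrite !mxE.
    rewrite (bigD1 i) //= mxE !eqxx mulr1 big1 ?addr0 // => k ki.
    by rewrite mxE (negPf ki) mulr0.
  by rewrite big1 // => m _; rewrite mxE (negPf kj) andbF mulr0.
have entry i j : A j i = (i == j)%:R * A ord0 ord0.
  have := base0 i j; rewrite mulmxBr raddfB /= tr_delta -scalemxAr mxtraceZ.
  by rewrite tr_delta => /eqP; rewrite subr_eq0 => /eqP.
have A00 : A ord0 ord0 = 0.
  move: trA; rewrite /mxtrace; under eq_bigr => i _ do rewrite entry eqxx mul1r.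
  rewrite sumr_const card_ord => /eqP; rewrite mulrn_eq0 /= => /eqP //.
by apply/matrixP => i j; rewrite entry A00 mulr0 mxE.
Qed.

(** The trace of [A *m curve s] is a nonzero polynomial in [s] of degree below [curve_len], so it
    has too few roots to exhaust the first [m + curve_len] integers. *)
Lemma curve_trace_nonroots (A : Mat) m :
  (0 < n)%N -> \tr A = 0 -> A != 0 ->
  exists S : seq nat, [/\ uniq S, (m <= size S)%N,
    (forall s, s \in S -> (s < m + curve_len)%N) &
    (forall s, s \in S -> \tr (A *m curve s) != 0)].
Proof.
move=> n0 trA A0; have [l0 Hl0] := curve_trace_neq0 n0 trA A0.
pose p : {poly int} := \poly_(l < curve_len) \tr (A *m curve_coef l).
have p0 : p != 0.
  apply/eqP => /polyP /(_ l0); rewrite coef_poly ltn_ord coef0.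
  by apply/eqP.
have pE s : p.[s%:Z] = \tr (A *m curve s).
  rewrite horner_poly curveE mulmx_sumr raddf_sum; apply: eq_bigr => l _.
  by rewrite /= mulrz_scalemx -scalemxAr mxtraceZ mulrC.
pose P s := \tr (A *m curve s) == 0.
exists [seq s <- iota 0 (m + curve_len) | ~~ P s]; split.
- by rewrite filter_uniq ?iota_uniq.
- rewrite size_filter -(leq_add2l (count P (iota 0 (m + curve_len)))).
  rewrite (count_predC P) size_iota addnC leq_add2l.
  rewrite -size_filter -(size_map Posz); apply: ltnW.
  apply: (@leq_trans (size p)); last exact: size_poly.
  apply: max_poly_roots => //.
    apply/allP => _ /mapP[s + ->]; rewrite mem_filter => /andP[/eqP Ps _].
    by rewrite /root pE Ps.
  by rewrite map_inj_uniq ?filter_uniq ?iota_uniq // => x y [].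
- by move=> s; rewrite mem_filter mem_iota add0n => /andP[].
- by move=> s; rewrite mem_filter => /andP[].
Qed.

(* Any [curve_len] points of the curve span a sublattice of finite index, whose
   index is controlled by a Vandermonde determinant. *)
Lemma curve_span (f : 'I_curve_len -> nat) (l : 'I_curve_len) :
  let W := Vandermonde curve_len (\row_k (f k)%:Z) in
  curve_coef l *~ \det W = \sum_k curve (f k) *~ (\adj W) k l.
Proof.
move=> W; under eq_bigr => k _ do rewrite curveE mulrz_suml.
rewrite exchange_big /= (bigD1 l) //=.
have E (l' : 'I_curve_len) :
  \sum_k curve_coef l' *~ (f k)%:Z ^+ l' *~ (\adj W) k l =
  curve_coef l' *~ (\det W *+ (l' == l)).
  rewrite -[\det W *+ _](_ : (W *m \adj W) l' l = _); last first.
    by rewrite mul_mx_adj mxE.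
  rewrite mxE mulrz_sumr; apply: eq_bigr => k _; rewrite !mxE.
  by rewrite -mulrzA.
rewrite E eqxx mulr1n big1 ?addr0 // => l' /negPf ne.
by rewrite E ne mulr0n mulr0z.
Qed.

(** Makes [curve_span] uniform in the points: only finitely many [f] take values below [M], so the
    product of their nonzero determinants is a common index [D0], and the sum of all coefficients is
    a common bound [C]. *)
Lemma curve_span_unif (M : nat) :
  exists2 D0 : nat, (0 < D0)%N & exists C : nat,
  forall f : {ffun 'I_curve_len -> 'I_M}, injective f ->
  forall l : 'I_curve_len, exists2 m : 'I_curve_len -> int,
    (\sum_k `|m k| <= C)%N & curve_coef l *+ D0 = \sum_k curve (f k) *~ m k.
Proof.
pose W (f : {ffun 'I_curve_len -> 'I_M}) :=
  Vandermonde curve_len (\row_k (f k : nat)%:Z).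
pose D0 := (\prod_(f : {ffun 'I_curve_len -> 'I_M} | injectiveb f) `|\det (W f)|)%N.
have detW0 (f : {ffun 'I_curve_len -> 'I_M}) : injective f -> \det (W f) != 0.
  move=> injf; rewrite det_Vandermonde.
  apply/prodf_neq0 => i _; apply/prodf_neq0 => j ltij; rewrite !mxE subr_eq0.
  apply/eqP => -[/val_inj/injf E]; by rewrite E ltnn in ltij.
exists D0.
  by apply: prodn_cond_gt0 => f /injectiveP /detW0; rewrite absz_gt0.
exists (\sum_(f : {ffun 'I_curve_len -> 'I_M}) \sum_l \sum_k
  `|((\adj (W f)) k l * (sgz (\det (W f)) * (D0 %/ `|\det (W f)|)%N))%R|)%N.
move=> f injf l.
exists (fun k => (\adj (W f)) k l * (sgz (\det (W f)) * (D0 %/ `|\det (W f)|)%N)).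
  rewrite (bigD1 f) //=; apply: leq_trans (leq_addr _ _).
  by rewrite [leqRHS](bigD1 l) //= leq_addr.
under eq_bigr => k _ do rewrite mulrzA.
rewrite -mulrz_suml -curve_span -mulrzA pmulrn; congr (_ *~ _).
rewrite mulrA [_ * sgz _]mulrC -abszEsg -PoszM mulnC divnK //.
rewrite /D0 (bigD1 f) /=; first exact: dvdn_mulr.
exact/injectiveP.
Qed.

End NilpotentCurve.

Lemma nat_above (R : realType) (x : R) : exists2 m : nat, (0 < m)%N & x <= m%:R.
Proof.
exists (Num.bound `|x|).+1 => //; apply: (le_trans (ler_norm x)).
by rewrite -natr1 ler_wpDr // ltW // archi_boundP.
Qed.

(** * Conjugation by unipotents and characters along the resulting quadratic orbits *)

Section UnipotentOrbit.
Variable n : nat.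
Local Notation Mat := 'M[int]_n.+1.
Implicit Types (A B : Mat) (s t : nat).

(** The conjugate of [A] by [1 + curve n s *+ (2 * t)], expanded as a quadratic polynomial in
    [t]. *)
Definition unip_orbit A s t : Mat :=
  A + ((curve n s *m A - A *m curve n s) *+ 2) *+ t
    + (curve n s *~ (- \tr (A *m curve n s) * 4)) *+ (t ^ 2).

Lemma unip_conj (v A : Mat) (a : nat) :
  (1 + v *+ a) * A * (1 - v *+ a) =
  A + (v * A - A * v) *+ a - v * A * v *+ (a * a).
Proof.
rewrite mulrDl mul1r mulrBr mulr1 mulrDl !mulrnAr !mulrnAl -mulrnA mulrnBl.
by rewrite opprD !addrA.
Qed.

(* The exponent is even so that the matrix is the square of a unit. *)
Lemma unip_det (v : Mat) (a : nat) : v * v = 0 -> \det (1 + v *+ (2 * a)) = 1.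
Proof.
move=> vv; have Eadd (x y : Mat) : x * y = 0 -> (1 + x) * (1 + y) = 1 + (x + y).
  by move=> xy; rewrite mulrDl mul1r mulrDr mulr1 xy addr0 addrAC -addrA.
have v2 (x y : nat) : v *+ x * (v *+ y) = 0.
  by rewrite mulrnAl mulrnAr vv !mul0rn.
have vN : v *+ a * - (v *+ a) = 0 by rewrite mulrN v2 oppr0.
have inv1 : \det (1 + v *+ a) * \det (1 - v *+ a) = 1.
  by rewrite -det_mulmx [_ *m _]Eadd // subrr addr0 det1.
have -> : 1 + v *+ (2 * a) = (1 + v *+ a) * (1 + v *+ a).
  by rewrite Eadd // mul2n -addnn mulrnDr.
rewrite -[_ * _]/(_ *m _) det_mulmx.
move: inv1; set x := \det _; set y := \det _ => xy.
have : `|x|%N = 1%N.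
  by have := congr1 absz xy; rewrite abszM => /eqP; rewrite muln_eq1 => /andP[/eqP].
by lia.
Qed.

Lemma unip_orbit_conj A s t :
  exists2 g : Mat, \det g = 1 & g *m A *m invmx g = unip_orbit A s t.
Proof.
set v := curve n s; have vv : v * v = 0 := curve_sqr n s.
exists (1 + v *+ (2 * t)); first exact: unip_det.
have gh : (1 + v *+ (2 * t)) *m (1 - v *+ (2 * t)) = 1%:M.
  rewrite -[_ *m _]/(_ * _) mulrDl mul1r mulrBr mulr1 mulrnAl mulrnAr vv !mul0rn.
  by rewrite subr0 subrK.
have -> : invmx (1 + v *+ (2 * t)) = 1 - v *+ (2 * t).
  have [ug _] := mulmx1_unit gh.
  by rewrite -[LHS]mulmx1 -gh mulKmx.
rewrite -[_ *m _ *m _]/(_ * _ * _) unip_conj /unip_orbit -/v -mulrnA.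
congr (_ + _ + _).
rewrite -[v * A * v]/(v *m A *m v) curve_sandwich -/v !pmulrn -!mulrzA -mulrNz.
by congr (v *~ _); rewrite -mulnn !PoszM; ring.
Qed.

Lemma conj_trace_dvd A (g : Mat) (k : nat) :
  \det g = 1 -> \tr A = 0 -> (forall i j, (k%:Z %| A i j)%Z) ->
  \tr (g *m A *m invmx g) = 0 /\
  forall i j, (k%:Z %| (g *m A *m invmx g) i j)%Z.
Proof.
move=> detg trA dvA; split.
  by rewrite -mulmxA mxtrace_mulC mulmxKV // unitmxE detg unitr1.
move=> i j; rewrite mxE; apply: rpred_sum => a _; rewrite dvdz_mulr // mxE.
by apply: rpred_sum => b _; rewrite dvdz_mull.
Qed.

(** Generators of the lattice of trace-zero matrices divisible by [K]; the pair [(ord0, ord0)]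
    contributes 0. *)
Definition tzscaled (K : nat) : seq Mat :=
  [seq tzbase p.1 p.2 *+ K | p <- enum [set: 'I_n.+1 * 'I_n.+1]%SET].

Lemma size_tzscaled K : size (tzscaled K) = (n.+1 ^ 2)%N.
Proof. by rewrite size_map -cardE cardsT card_prod card_ord expnS expn1. Qed.

Lemma mem_tzscaled K i j : tzbase i j *+ K \in tzscaled K.
Proof. by apply/mapP; exists (i, j); rewrite // mem_enum inE. Qed.

Lemma tzscaledP K (P : Mat -> Prop) :
  (forall i j, P (tzbase i j *+ K)) -> forall b, b \in tzscaled K -> P b.
Proof. by move=> HP b /mapP[[i j] _ ->]; apply: HP. Qed.

Section Characters.
Variable R : realType.
Variable chi : Mat -> R[i].
Hypothesis chiP : unitary_char chi.

Lemma cdist_trace0 (B : Mat) (k : nat) (rho : R) :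
  (0 < k)%N -> 0 <= rho -> \tr B = 0 -> (forall i j, (k%:Z %| B i j)%Z) ->
  (forall i j, cdist chi (tzbase i j *+ k) <= rho) ->
  cdist chi B <= (\sum_i \sum_j `|B i j|)%N%:R * rho.
Proof.
move=> k0 rho0 trB dvB Hb; rewrite {1}(trace0_decomp trB).
rewrite (le_trans (cdist_sum chiP _ _ _)) // natr_sum mulr_suml.
apply: ler_sum => i _; rewrite (le_trans (cdist_sum chiP _ _ _)) //.
rewrite natr_sum mulr_suml; apply: ler_sum => j _.
have /dvdzP[q Eq] := dvB i j; rewrite Eq mulrC mulrzA -pmulrn.
rewrite (le_trans (cdistMz chiP _ _)) // ler_pM ?cdist_ge0 // ler_nat.
by rewrite abszM absz_nat leq_pmull.
Qed.

(** Along the orbit [chi] is [chi A] times a quadratic phase, to which [quadratic_phase_sum]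
    applies. The conditions on [H] and on [T] bound the diagonal and the off-diagonal terms by half
    of the target each. *)
Lemma unip_orbit_sum A s (H T : nat) (eta e : R) : 0 < eta -> 0 < e ->
  2 <= H%:R * e ^+ 2 -> 4 * H`!%:R <= eta * e ^+ 2 * T%:R ->
  eta <= cdist chi (curve n s *+ (8 * `|\tr (A *m curve n s)| * H`!)) ->
  cabs (\sum_(a < T) \sum_(h < H) chi (unip_orbit A s (a + h))) <=
  e * (T%:R * H%:R).
Proof.
move=> eta0 e0 HH HT Hfar; have [chiD chi1] := chiP.
set v := curve n s; set c := \tr _ in Hfar *.
pose be := chi ((v *m A - A *m v) *+ 2); pose al := chi (v *~ (- c * 4)).
have -> : \sum_(a < T) \sum_(h < H) chi (unip_orbit A s (a + h)) =
   chi A * \sum_(a < T) \sum_(h < H) be ^+ (a + h) * al ^+ ((a + h) ^ 2).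
  rewrite mulr_sumr; apply: eq_bigr => a _; rewrite mulr_sumr.
  apply: eq_bigr => h _; rewrite /unip_orbit !chiD (charMn chiP _ (a + h)).
  by rewrite (charMn chiP _ ((a + h) ^ 2)) mulrA.
rewrite cabsM chi1 mul1r.
(* Passing from [c] to its absolute value is harmless because [cdist] is even. *)
have Eal : cabs (al ^+ (2 * H`!) - 1) =
    cdist chi (v *+ (8 * `|c| * H`!)).
  rewrite -(charMn chiP) -/(cdist chi _) [in LHS]pmulrn -mulrzA.
  have [E|E] : c = `|c|%N%:Z \/ c = - `|c|%N%:Z by lia.
  - rewrite {1}E -(cdistN chiP) -mulrNz [in RHS]pmulrn.
    by congr (cdist _ (_ *~ _)); rewrite !PoszM; ring.
  - rewrite {1}E [in RHS]pmulrn.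
    by congr (cdist _ (_ *~ _)); rewrite !PoszM; ring.
have := @quadratic_phase_sum R al be H T eta (chi1 _) (chi1 _) eta0.
rewrite Eal => /(_ Hfar) => Hq.
rewrite -(@ler_pXn2r _ 2) ?nnegrE ?cabs_ge0 ?mulr_ge0 // ?(ltW e0) //.
apply: (le_trans Hq); rewrite !exprMn natrX.
set x : R := T%:R; set y : R := H%:R; set f : R := H`!%:R.
have x0 : 0 <= x by []. have y0 : 0 <= y by [].
have -> : 2 * f / eta = (4 * f) / eta / 2 by field; rewrite gt_eqF.
have f1 : 4 * f / eta <= e ^+ 2 * x by rewrite ler_pdivrMr //; move: HT; rewrite -/x -/f; lra.
have f2 : y ^+ 2 * (4 * f / eta / 2) <= y ^+ 2 * (e ^+ 2 * x / 2).
  by rewrite ler_wpM2l ?sqr_ge0 // ler_wpM2r.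
have f3 : y * x * 2 <= y * x * (y * e ^+ 2) by rewrite ler_wpM2l ?mulr_ge0.
apply: (@le_trans _ _ (x * (y * x * (y * e ^+ 2) / 2 + y ^+ 2 * (e ^+ 2 * x / 2)))).
  rewrite ler_wpM2l // lerD // ; lra.
by rewrite le_eqVlt; apply/orP; left; apply/eqP; field.
Qed.

End Characters.
End UnipotentOrbit.

(** * The averaging inequality for conjugates of one matrix *)

Section KeyInequality.
Variables (R : realType) (n : nat).
Local Notation Mat := 'M[int]_n.+1.
Local Notation r := (curve_len n).
Implicit Types (A B : Mat) (s t : nat) (S : seq nat).

Definition orbit_list A S (T H : nat) : seq Mat :=
  [seq unip_orbit A s q | s <- S, q <- [seq a + h | a <- iota 0 T, h <- iota 0 H]%N].

Definition curve_period A (H s : nat) : nat := (8 * `|\tr (A *m curve n s)| * H`!)%N.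

(** A parameter [s] far from trivial contributes at most [e] by [unip_orbit_sum]; a bad one is
    bounded trivially by 1. *)
Lemma cavg_orbit_list A S (T H : nat) (eta e : R) (chi : Mat -> R[i]) :
  unitary_char chi -> (0 < T)%N -> (0 < H)%N -> (0 < size S)%N ->
  0 < eta -> 0 < e ->
  2 <= H%:R * e ^+ 2 -> 4 * H`!%:R <= eta * e ^+ 2 * T%:R ->
  cabs (cavg (orbit_list A S T H) chi) <=
  e + (count (fun s => cdist chi (curve n s *+ curve_period A H s) < eta) S)%:R
      / (size S)%:R.
Proof.
move=> chiP T0 H0 S0 eta0 e0 HH HT; set bad := fun s => _ < eta.
have [_ chi1] := chiP.
have TH0 : 0 < T%:R * H%:R :> R by rewrite mulr_gt0 ?ltr0n.
have S0R : 0 < (size S)%:R :> R by rewrite ltr0n.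
rewrite /cavg /orbit_list !size_allpairs !size_iota big_allpairs_dep.
rewrite cabsM cabsV cabs_nat natrM natrM ler_pdivrMr ?mulr_gt0 ?ltr0n //.
rewrite (le_trans (cabs_sum _ _ _)) //.
apply: (@le_trans _ _ (\sum_(s <- S) (e + (bad s)%:R) * (T%:R * H%:R))).
  apply: ler_sum => s _; rewrite big_allpairs_dep /=.
  have -> : \sum_(a <- iota 0 T) \sum_(h <- iota 0 H) chi (unip_orbit A s (a + h)) =
            \sum_(a < T) \sum_(h < H) chi (unip_orbit A s (a + h)).
    have E k F : \sum_(a <- iota 0 k) F a = \sum_(a < k) F a :> R[i].
      by rewrite -(big_mkord xpredT F) /index_iota subn0.
    by rewrite E; apply: eq_bigr => a _; rewrite E.
  case: (ltP (cdist chi (curve n s *+ curve_period A H s)) eta) => [near|far].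
    rewrite /bad near mulrDl mul1r ler_wpDl ?mulr_ge0 ?(ltW e0) //.
    rewrite (le_trans (cabs_sum _ _ _)) //.
    rewrite -natrM -[X in (X * _)%N%:R]card_ord -sum_nat_const natr_sum.
    apply: ler_sum => a _; rewrite (le_trans (cabs_sum _ _ _)) //.
    under eq_bigr do rewrite chi1.
    by rewrite sumr_const card_ord.
  rewrite /bad ltNge far addr0; exact: (unip_orbit_sum chiP eta0 e0 HH HT far).
rewrite -mulr_suml big_split /= big_const_seq count_predT iter_addr_0.
have -> : \sum_(s <- S) (bad s)%:R = (count bad S)%:R :> R.
  by rewrite -natr_sum -sum1_count [in RHS]big_mkcond.
rewrite [leRHS]mulrA ler_wpM2r ?(ltW TH0) //.
by rewrite mulrDl divfK ?gt_eqF // mulr_natr.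
Qed.

Lemma seq_ffun S M (P : pred nat) : uniq S -> (forall s, s \in S -> (s <= M)%N) ->
  (r <= count P S)%N ->
  exists2 f : {ffun 'I_r -> 'I_M.+1}, injective f & forall k, (f k : nat) \in S /\ P (f k).
Proof.
move=> uS SM cP; pose q := [seq s <- S | P s].
have szq : (r <= size q)%N by rewrite size_filter.
have inq (k : 'I_r) : nth 0%N q k \in q by rewrite mem_nth // (leq_trans (ltn_ord k)).
have fE (k : 'I_r) : (inord (nth 0%N q k) : 'I_M.+1) = nth 0%N q k :> nat.
  by rewrite inordK // ltnS SM //; have := inq k; rewrite mem_filter => /andP[].
exists [ffun k : 'I_r => inord (nth 0%N q k) : 'I_M.+1].
  move=> a b; rewrite !ffunE => /(congr1 val); rewrite /= !fE => /eqP.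
  rewrite nth_uniq ?filter_uniq ?(leq_trans (ltn_ord _)) // => /eqP E.
  exact: val_inj.
move=> k; rewrite ffunE fE; have := inq k; rewrite mem_filter => /andP[].
by [].
Qed.

(** The common multiple [K0] of the periods makes [chi] nearly trivial on the same multiple of
    [curve_len] bad curve points. These span the coefficients up to [D0], and two coefficients give
    each [tzbase i j], whence the factor 2. *)
Lemma tzbase_near S M A (H k D0 C K0 : nat) (eta : R) (chi : Mat -> R[i]) :
  (0 < n)%N -> unitary_char chi -> 0 <= eta ->
  uniq S -> (forall s, s \in S -> (s <= M)%N) ->
  (forall f : {ffun 'I_r -> 'I_M.+1}, injective f ->
   forall l : 'I_r, exists2 m : 'I_r -> int,
    (\sum_a `|m a| <= C)%N & curve_coef n l *+ D0 = \sum_a curve n (f a) *~ m a) ->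
  (0 < K0)%N -> (forall s, s \in S -> (curve_period A H s %| K0)%N) ->
  (r <= count (fun s => (cdist chi (curve n s *+ curve_period A H s) < eta)%R) S)%N ->
  forall i j, cdist chi (tzbase i j *+ (k * D0 * K0)) <=
    (2 * k * C * K0)%N%:R * eta.
Proof.
move=> n0 chiP eta0 uS SM span K00 dvK cbad i j.
have [f injf Hf] := seq_ffun uS SM cbad.
have Hv a : cdist chi (curve n (f a) *+ K0) <= K0%:R * eta.
  have [fS bad] := Hf a; have /dvdnP[q Eq] := dvK _ fS.
  rewrite Eq mulnC mulrnA (le_trans (cdistMn chiP _ _)) // ler_pM ?cdist_ge0 ?(ltW bad) //.
  rewrite ler_nat leq_pmull //; move: K00; rewrite Eq muln_gt0; case/andP => //.
have Hc (l : 'I_r) (z : int) : (`|z| <= 1)%N ->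
    cdist chi (curve_coef n l *+ (k * D0 * K0) *~ z) <= (k * C * K0)%N%:R * eta.
  move=> z1; have [m mC Em] := span f injf l.
  have -> : (k * D0 * K0 = D0 * (K0 * k))%N by lia.
  rewrite mulrnA Em mulrnA.
  apply: (le_trans (cdistMz chiP _ _)).
  apply: (@le_trans _ _ (1 * cdist chi ((\sum_a curve n (f a) *~ m a) *+ K0 *+ k))).
    by rewrite ler_wpM2r ?cdist_ge0 // lern1.
  rewrite mul1r (le_trans (cdistMn chiP _ _)) //.
  rewrite -!mulnA natrM -[leRHS]mulrA ler_wpM2l //.
  rewrite -sumrMnl (le_trans (cdist_sum chiP _ _ _)) //.
  apply: (@le_trans _ _ (\sum_a `|m a|%:R * (K0%:R * eta))).
    apply: ler_sum => a _; rewrite pmulrn mulrzAC -pmulrn.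
    by rewrite (le_trans (cdistMz chiP _ _)) // ler_wpM2l.
  by rewrite -mulr_suml -natr_sum natrM -[leRHS]mulrA ler_wpM2r ?mulr_ge0 // ler_nat.
have [l1 [l2 [a1 [a2 [A1 A2 ->]]]]] := tzbase_coef i j n0.
rewrite mulrnDl (le_trans (cdistD chiP _ _)) //.
rewrite ![_ *~ _ *+ _]pmulrn ![_ *~ _ *~ Posz _]mulrzAC -!pmulrn.
have := Hc l1 a1 A1; have := Hc l2 a2 A2.
by rewrite -!mulnA (natrM _ 2); lra.
Qed.

(** The order of choices matters: [K] is fixed before [L], whereas [rho], [eta], [T], [nu] and [L']
    may depend on [L]. Three kinds of characters are then treated separately. *)
Lemma key_inequality (e : R) (k : nat) A :
  (0 < n)%N -> 0 < e -> e <= 1 -> (0 < k)%N ->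
  \tr A = 0 -> (forall i j, (k%:Z %| A i j)%Z) -> A != 0 ->
  exists2 K : nat, (0 < K)%N & forall L, (0 < L)%N ->
  exists2 L' : nat, (0 < L')%N & exists nu : seq Mat,
  [/\ (0 < size nu)%N,
      (forall B, B \in nu -> exists2 g : Mat, \det g = 1 & g *m A *m invmx g = B) &
      forall chi : Mat -> R[i], unitary_char chi ->
        0 <= cRe (cavg nu chi) + 4 * e
           + cRe (cavg (fejer L (tzscaled n K)) chi)
           - 2 * cRe (cavg (fejer L' (tzscaled n k)) chi)].
Proof.
move=> n0 e0 e1 k0 trA dvA A0.
have ne : e != 0 by rewrite gt_eqF.
have [H H0 HH] := nat_above (2 / e ^+ 2).
(* Fewer than [r] bad parameters among at least [m] form a proportion at most [e]. *)
have [m m0 Hm] := nat_above (r%:R / e).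
have [S [uS mS SM cS]] := curve_trace_nonroots m n0 trA A0.
have [D0 D00 [C span]] := curve_span_unif n (m + r).+1.
pose K0 := (\prod_(s <- S) curve_period A H s)%N.
have K00 : (0 < K0)%N.
  rewrite /K0 big_seq prodn_cond_gt0 // => s sS.
  by rewrite !muln_gt0 absz_gt0 cS // fact_gt0.
have dvK s : s \in S -> (curve_period A H s %| K0)%N.
  by move=> sS; rewrite /K0 (big_rem s) //= dvdn_mulr.
have K_gt0 : (0 < k * D0 * K0)%N by rewrite !muln_gt0 k0 D00 K00.
exists (k * D0 * K0)%N => // L L0; set K := (k * D0 * K0)%N in K_gt0 *.
pose N := (n.+1 ^ 2 * L)%N.
(* [rho] is the closeness on the generators that brings the kernel of [K] within [e] of 1. *)
pose rho : R := e / (2 * N%:R + 1).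
have posN (x : nat) : 0 < x%:R + 1 :> R by rewrite ltr_wpDl.
have pos2N : 0 < 2 * N%:R + 1 :> R by rewrite ltr_wpDl // mulr_ge0.
have rho0 : 0 < rho by rewrite divr_gt0.
have Hrho : 2 * (N%:R * rho) <= e.
  rewrite /rho mulrA mulrA ler_pdivrMr // mulrC ler_wpM2l ?(ltW e0) //.
  by rewrite lerDl.
pose Q := (2 * k * C * K0)%N.
(* [Q] is the loss in [tzbase_near]. *)
pose eta : R := rho / (Q%:R + 1).
have eta0 : 0 < eta by rewrite divr_gt0.
have Heta : Q%:R * eta <= rho.
  by rewrite /eta mulrA ler_pdivrMr // mulrC ler_wpM2l ?(ltW rho0) // lerDl.
have [T T0 HT] := nat_above (4 * H`!%:R / (eta * e ^+ 2)).
pose nu := orbit_list A S T H.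
pose Cnu := (\sum_(B <- nu) \sum_i \sum_j `|B i j|)%N.
(* Small enough that closeness [rho'] on the generators for [k] passes both to all of [nu], through
   [Cnu], and to the generators for [K]. *)
pose rho' : R := Num.min e rho / ((Cnu + K)%N%:R + 1).
have min0 : 0 < Num.min e rho by rewrite lt_min e0 rho0.
have rho'0 : 0 < rho' by rewrite divr_gt0.
have Hrho' : (Cnu + K)%N%:R * rho' <= Num.min e rho.
  by rewrite /rho' mulrA ler_pdivrMr // mulrC ler_wpM2l ?(ltW min0) // lerDl.
have [L' L'0 HL'] := nat_above (2 / (rho' * e)).
have nuP B : B \in nu -> exists2 g : Mat, \det g = 1 & g *m A *m invmx g = B.
  by move=> /allpairsP[[s q] [_ _ ->]]; apply: unip_orbit_conj.
have S0 : (0 < size S)%N by apply: leq_trans mS.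
have nu0 : (0 < size nu)%N.
  by rewrite !size_allpairs !size_iota !muln_gt0 S0 T0 H0.
exists L' => //; exists nu; split=> // chi chiP.
have nearK : (forall i j, cdist chi (tzbase i j *+ K) <= rho) ->
    1 - e <= cRe (cavg (fejer L (tzscaled n K)) chi).
  move=> Hb; apply: le_trans (fejer_near chiP L0 (ltW rho0) (tzscaledP Hb)).
  by rewrite size_tzscaled lerD2l lerN2.
have K_ge0 := fejer_ge0 chiP L (tzscaled n K).
have k_le1 := fejer_le1 chiP L' (tzscaled n k).
(* If [chi] is nearly trivial on the lattice of [k], then [nu] and the kernel of [K] both have real
   part at least [1 - e], which outweighs the subtracted 2. *)
case: (pselect (forall i j, cdist chi (tzbase i j *+ k) <= rho')) => [neark|fark].
  have /nearK Kge : forall i j, cdist chi (tzbase i j *+ K) <= rho.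
    move=> i j; rewrite /K -mulnA mulrnA (le_trans (cdistMn chiP _ _)) //.
    apply: (@le_trans _ _ ((Cnu + K)%N%:R * rho')); last first.
      by rewrite (le_trans Hrho') // ge_min lexx orbT.
    rewrite ler_pM ?cdist_ge0 // ler_nat /K -mulnA.
    by rewrite (leq_trans (leq_pmull _ k0)) // leq_addl.
  have near1 : cabs (cavg nu chi - 1) <= e.
    apply: cavg_dist => // B Bnu; have [g detg EB] := nuP B Bnu.
    have [trB dvB] := conj_trace_dvd detg trA dvA.
    rewrite EB in trB dvB.
    rewrite (le_trans (cdist_trace0 chiP k0 (ltW rho'0) trB dvB neark)) //.
    apply: (@le_trans _ _ ((Cnu + K)%N%:R * rho')); last first.
      by rewrite (le_trans Hrho') // ge_min lexx.
    rewrite ler_wpM2r ?(ltW rho'0) // ler_nat.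
    by rewrite (leq_trans _ (leq_addr _ _)) // /Cnu (big_rem B) //= leq_addr.
  have ReB : 1 - e <= cRe (cavg nu chi).
    have := cRe_ge (cavg nu chi - 1).
    have -> : cRe (cavg nu chi - 1) = cRe (cavg nu chi) - 1.
      by rewrite cReD; congr (_ + _); rewrite /cRe /= .
    by lra.
  by lra.
have k_lee : cRe (cavg (fejer L' (tzscaled n k)) chi) <= e.
  have [i [j Hij]] : exists i j, rho' < cdist chi (tzbase i j *+ k).
    apply: contra_notP fark => no i j; rewrite leNgt; apply/negP => Hij.
    by apply: no; exists i, j.
  apply: (le_trans (fejer_far chiP L'0 rho'0 (mem_tzscaled k i j) Hij)).
  have x0 : 0 <= 2 / (L'%:R * rho') by rewrite divr_ge0 // mulr_ge0 // ltW.
  have xe : 2 / (L'%:R * rho') <= e.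
    rewrite ler_pdivrMr ?mulr_gt0 ?ltr0n //.
    move: HL'; rewrite ler_pdivrMr ?mulr_gt0 //; lra.
  by rewrite expr2 (le_trans (ler_pM x0 x0 xe (le_trans xe e1))) // mulr1.
have nu_ge : -1 <= cRe (cavg nu chi).
  by have := cRe_ge (cavg nu chi); have := cabs_cavg chiP nu; lra.
pose bad s := cdist chi (curve n s *+ curve_period A H s) < eta.
(* The kernel of [k] is now at most [e]. With many bad parameters the kernel of [K] is at least
   [1 - e] and offsets the trivial bound -1 for [nu]; with few, the transform of [nu] has modulus at
   most [2 * e]. *)
case: (leqP r (count bad S)) => [many|few].
  have /nearK : forall i j, cdist chi (tzbase i j *+ K) <= rho.
    move=> i j; apply: le_trans Heta.
    have SM' s : s \in S -> (s <= m + r)%N by move=> /SM /ltnW.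
    exact: (tzbase_near k n0 chiP (ltW eta0) uS SM' span K00 dvK many).
  by lra.
have : cabs (cavg nu chi) <= e + (count bad S)%:R / (size S)%:R.
  apply: cavg_orbit_list => //.
    by move: HH; rewrite ler_pdivrMr // exprn_gt0.
  by move: HT; rewrite ler_pdivrMr ?mulr_gt0 ?exprn_gt0 // [T%:R * _]mulrC.
have : (count bad S)%:R / (size S)%:R <= e.
  rewrite ler_pdivrMr ?ltr0n //; apply: (@le_trans _ _ r%:R).
    by rewrite ler_nat ltnW.
  move: Hm; rewrite ler_pdivrMr // mulrC => /le_trans; apply.
  by rewrite ler_wpM2l ?(ltW e0) // ler_nat.
by have := cRe_ge (cavg nu chi); lra.
Qed.

End KeyInequality.

(** * Finite Fourier analysis on trace-zero matrices *)

Section FourierPositivity.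
Variables (R : realType) (n : nat).
Local Notation Mat := 'M[int]_n.+1.

(** Positions other than the last diagonal one; their entries are free coordinates, the last entry
    being determined by the trace. *)
Definition free_entry : finType :=
  {p : 'I_n.+1 * 'I_n.+1 | p != (ord_max, ord_max)}.
Definition entry (B : Mat) (p : free_entry) : int := B (val p).1 (val p).2.

Lemma complex_prim_root (m : nat) : (0 < m)%N -> exists z : R[i], m.-primitive_root z.
Proof.
move=> m_gt0; pose p : {poly R[i]} := 'X^m - 1.
have [r Dp] := closed_field_poly_normal p.
rewrite (monicP _) ?monicXnsubC // scale1r in Dp.
have rm1 : all m.-unity_root r by apply/allP=> z; rewrite -root_prod_XsubC -Dp.
have sz_r : (m < (size r).+1)%N.
  by rewrite -(size_prod_XsubC r id) -Dp size_XnsubC.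
have [|z] := hasP (has_prim_root m_gt0 rm1 _ sz_r); last by exists z.
by rewrite -separable_prod_XsubC -Dp separable_Xn_sub_1 // pnatr_eq0 -lt0n.
Qed.

Lemma cabs_prim_root m (z : R[i]) : m.-primitive_root z -> cabs z = 1.
Proof.
move=> pz; have m0 := prim_order_gt0 pz.
apply/eqP; rewrite -(pexpr_eq1 m0) ?cabs_ge0 // -cabsX prim_expr_order //.
by rewrite cabs1.
Qed.

Lemma cabs_exprz (z : R[i]) (m : int) : cabs z = 1 -> cabs (z ^ m) = 1.
Proof.
by move=> z1; case: m => a; rewrite ?NegzE -?invr_expz ?cabsV cabsX z1 expr1n ?invr1.
Qed.

Lemma prim_root_sum m (z : R[i]) (b : int) : m.-primitive_root z -> (`|b| < m)%N ->
  \sum_(a < m) (z ^+ a) ^ b = (b == 0)%:R * m%:R.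
Proof.
move=> pz ltb; have z1 := cabs_prim_root pz; have z0 := cabs1_neq0 z1.
have -> : \sum_(a < m) (z ^+ a) ^ b = \sum_(a < m) (z ^ b) ^+ a.
  by apply: eq_bigr => a _; rewrite !exprnP !exprz_exp mulrC.
case: eqVneq => [->|b0].
  by under eq_bigr do rewrite expr0z expr1n; rewrite sumr_const card_ord mul1r.
have zb : z ^ b != 1.
  have E : z ^+ `|b| != 1.
    by rewrite -(prim_order_dvd pz) gtnNdvd // absz_gt0.
  case: b {ltb b0} E => a; first by rewrite absz_nat.
  by rewrite NegzE abszN absz_nat -invr_expz => E; rewrite invr_eq1.
apply: (mulfI (_ : z ^ b - 1 != 0)); first by rewrite subr_eq0.
rewrite -subrX1 exprnP exprz_exp mulrC -exprz_exp -exprnP prim_expr_order //.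
by rewrite exp1rz subrr mul0r mulr0.
Qed.

Section DualGroup.
Variables (m : nat) (z : R[i]).
Hypothesis pz : m.+1.-primitive_root z.

(** The characters of the free coordinates taken modulo [m.+1]. *)
Definition dual_char (j : {ffun free_entry -> 'I_m.+1}) (B : Mat) : R[i] :=
  \prod_p (z ^+ j p) ^ (entry B p).

Lemma dual_charP j : unitary_char (dual_char j).
Proof.
have z1 := cabs_prim_root pz.
have zj p : cabs (z ^+ j p) = 1 by rewrite cabsX z1 expr1n.
split=> [x y|x].
  rewrite /dual_char -big_split; apply: eq_bigr => p _ /=.
  by rewrite /entry mxE -expfzDr ?cabs1_neq0.
rewrite /dual_char; elim/big_rec: _ => [|p w _ w1]; first exact: cabs1.
by rewrite cabsM w1 mulr1 cabs_exprz.
Qed.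

Lemma dual_char0 B : dual_char [ffun=> ord0] B = 1.
Proof. by rewrite /dual_char big1 // => p _; rewrite ffunE expr0 exp1rz. Qed.

Lemma trace0_entry (B : Mat) : \tr B = 0 -> (forall p, entry B p = 0) -> B = 0.
Proof.
move=> trB B0; have E i j : (i, j) != (ord_max, ord_max) -> B i j = 0.
  by move=> ij; apply: (B0 (exist _ (i, j) ij)).
apply/matrixP => i j; rewrite mxE.
have [/eqP[-> ->]|/E //] := boolP ((i, j) == (ord_max, ord_max)).
move: trB; rewrite /mxtrace (bigD1 ord_max) //= big1 ?addr0 // => k km.
by rewrite E // xpair_eqE negb_and km.
Qed.

(** A nonzero entry of size at most [m] stays nonzero modulo [m.+1], so its factor in the product of
    sums vanishes. *)
Lemma dual_char_sum (B : Mat) : \tr B = 0 ->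
  (forall p, (`|entry B p| <= m)%N) ->
  \sum_j dual_char j B = (B == 0)%:R * (m.+1 ^ #|free_entry|)%:R.
Proof.
move=> trB ltB; rewrite /dual_char.
rewrite -(bigA_distr_bigA (fun p a => (z ^+ nat_of_ord a) ^ entry B p)) /=.
under eq_bigr => p _ do rewrite prim_root_sum ?ltnS //.
case: eqVneq => [->|B0].
  under eq_bigr => p _ do rewrite /entry mxE eqxx mul1r.
  by rewrite prodr_const mul1r natrX.
have [p Hp] : exists p, entry B p != 0.
  apply: contra_neqP B0 => /forallNP no; apply: trace0_entry => // p.
  by apply/eqP; have := no p; case: eqP.
by rewrite (bigD1 p) //= (negPf Hp) !mul0r.
Qed.

End DualGroup.

Definition corr (X : seq Mat) (B : Mat) : nat := (\sum_(x <- X) (x + B \in X)%R)%N.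

Lemma corr_pairs (X : seq Mat) (B : Mat) : uniq X ->
  corr X B = (\sum_(x <- X) \sum_(y <- X) (B + (x - y) == 0)%R)%N.
Proof.
move=> uX; rewrite /corr; apply: eq_bigr => x _.
have E y : (B + (x - y) == 0) = (pred1 (x + B) y).
  by rewrite addrA subr_eq0 [B + x]addrC eq_sym.
under eq_bigr => y _ do rewrite E.
by rewrite -(count_uniq_mem _ uX) -sum1_count big_mkcond.
Qed.

(** Sum the transform of [ps] times the squared modulus of that of [X] over the dual group.
    Orthogonality turns the sum into correlations; [3 * N <= m] excludes wrap-around in
    [q.2 + (x - y)]. All terms are nonnegative and the trivial character alone gives the left
    side. *)
Lemma corr_positivity (X : seq Mat) (ps : seq (R * Mat)) (N m : nat) :
  uniq X -> (3 * N <= m)%N ->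
  (forall x, x \in X -> \tr x = 0 /\ forall p, (`|entry x p| <= N)%N) ->
  (forall q, q \in ps -> \tr q.2 = 0 /\ forall p, (`|entry q.2 p| <= N)%N) ->
  (forall chi : Mat -> R[i], unitary_char chi ->
     0 <= cRe (\sum_(q <- ps) q.1%:C%C * chi q.2)) ->
  (\sum_(q <- ps) q.1) * (size X)%:R ^+ 2 <=
  (m.+1 ^ #|free_entry|)%:R * \sum_(q <- ps) q.1 * (corr X q.2)%:R.
Proof.
move=> uX Nm HX Hps pos; have [z pz] := complex_prim_root (ltn0Sn m).
pose ch j := @dual_char m z j; have chP j : unitary_char (ch j) := dual_charP pz j.
pose P j := \sum_(q <- ps) q.1%:C%C * ch j q.2.
pose S j := \sum_(x <- X) ch j x.
have main : \sum_j P j * (S j * conjc (S j)) =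
    ((m.+1 ^ #|free_entry|)%:R * \sum_(q <- ps) q.1 * (corr X q.2)%:R)%:C%C.
  transitivity (\sum_(q <- ps) q.1%:C%C *
      \sum_(x <- X) \sum_(y <- X) \sum_j ch j (q.2 + (x - y))).
    under eq_bigr => j _ do rewrite mulr_suml.
    rewrite exchange_big /=; apply: eq_bigr => q _.
    under eq_bigr => j _ do rewrite -mulrA.
    rewrite -mulr_sumr; congr (_ * _).
    under [RHS]eq_bigr => x _ do rewrite exchange_big /=.
    rewrite [RHS]exchange_big /=; apply: eq_bigr => j _.
    rewrite /S rmorph_sum mulr_suml mulr_sumr; apply: eq_bigr => x _.
    rewrite !mulr_sumr; apply: eq_bigr => y _.
    by have [chD _] := chP j; rewrite !chD (charN (chP j)).
  rewrite rmorphM rmorph_sum rmorph_nat mulr_sumr /=.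
  rewrite big_seq [RHS]big_seq; apply: eq_bigr => q qps.
  have [trq Nq] := Hps q qps.
  rewrite rmorphM /= mulrCA; congr (_ * _).
  rewrite corr_pairs // rmorph_nat natr_sum mulr_sumr.
  rewrite big_seq [RHS]big_seq; apply: eq_bigr => x xX.
  rewrite natr_sum mulr_sumr big_seq [RHS]big_seq; apply: eq_bigr => y yX.
  have [trx Nx] := HX x xX; have [try Ny] := HX y yX.
  rewrite dual_char_sum // 1?mulrC //.
    by rewrite !mxtraceD raddfN /= trq trx try oppr0 !addr0.
  move=> p; have := Nx p; have := Ny p; have := Nq p; rewrite /entry !mxE.
  move: (q.2 _ _) (x _ _) (y _ _) => a b c Ha Hb Hc.
  by clear -Ha Hb Hc Nm; lia.
have : cRe (\sum_j P j * (S j * conjc (S j))) =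
       \sum_j cRe (P j) * cabs (S j) ^+ 2.
  by rewrite cRe_sum; apply: eq_bigr => j _; rewrite mul_conj cReMr.
rewrite main cRe_real => ->.
rewrite (bigD1 [ffun=> ord0]) //= ler_wpDr //.
  by apply: sumr_ge0 => j _; rewrite mulr_ge0 ?sqr_ge0 // pos.
have -> : S [ffun=> ord0] = (size X)%:R.
  rewrite /S; under eq_bigr => x _ do rewrite /ch dual_char0.
  by rewrite big_const_seq count_predT iter_addr_0.
have -> : P [ffun=> ord0] = (\sum_(q <- ps) q.1)%:C%C.
  rewrite /P rmorph_sum; apply: eq_bigr => q _.
  by rewrite /ch dual_char0 mulr1.
by rewrite cRe_real cabs_nat.
Qed.

End FourierPositivity.

(** * The boxes [Fn], their cardinality, and slices of a set *)

Section TraceZeroBox.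
Variable n : nat.
Local Notation Mat := 'M[int]_n.+1.

Lemma FnE (m : nat) (A : Mat) :
  Fn n.+1 m A <-> \tr A = 0 /\ forall p, (`|entry A p| <= m)%N.
Proof.
split=> -[trA HA]; split=> //.
  move=> [[i j] /= ij]; have := HA i j; rewrite /entry /=.
  move=> H; have {H} : `|A i j| <= m%:Z.
    by apply: H => -[Ei Ej]; move/eqP: ij; apply; congr pair; apply: val_inj.
  by lia.
move=> i j ij; have ne : (i, j) != (ord_max, ord_max).
  by apply/eqP => -[Ei Ej]; apply: ij; rewrite Ei Ej.
by have := HA (exist _ (i, j) ne); rewrite /entry /=; lia.
Qed.

(** Parametrizes the box: free entries are shifted by [m], and the last diagonal entry is set so
    that the trace vanishes. *)
Definition box_mx (m : nat) (f : {ffun free_entry n -> 'I_(2 * m).+1}) : Mat :=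
  let x i j : int := if insub (i, j) is Some p then (f p)%:Z - m%:Z else 0 in
  \matrix_(i, j) if (i, j) == (ord_max, ord_max)
    then - \sum_(k < n.+1 | k != ord_max) x k k else x i j.

Lemma box_mx_entry m f p : entry (@box_mx m f) p = (f p)%:Z - m%:Z.
Proof.
rewrite /entry /box_mx mxE -surjective_pairing (negPf (valP p)).
by rewrite valK.
Qed.

Lemma box_mx_inj m : injective (@box_mx m).
Proof.
move=> f g E; apply/ffunP => p; have := congr1 (fun A => entry A p) E.
by rewrite /= !box_mx_entry => /addIr[/val_inj].
Qed.

Lemma box_mx_trace m f : \tr (@box_mx m f) = 0.
Proof.
rewrite /mxtrace (bigD1 ord_max) //= {1}/box_mx mxE eqxx addrC.
apply/eqP; rewrite subr_eq0; apply/eqP; apply: eq_bigr => k km.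
by rewrite mxE xpair_eqE (negPf km).
Qed.

Lemma entry_inj (A B : Mat) : \tr A = \tr B -> entry A =1 entry B -> A = B.
Proof.
move=> trAB eAB; apply/eqP; rewrite -subr_eq0; apply/eqP; apply: trace0_entry.
  by rewrite raddfB /= trAB subrr.
by move=> p; have := eAB p; rewrite /entry !mxE => ->; rewrite subrr.
Qed.

Lemma Fn_box m : Fn n.+1 m =
  [set` [fset x in [seq box_mx f | f <- enum {ffun free_entry n -> 'I_(2 * m).+1}]]%fset].
Proof.
apply/seteqP; split=> A /=; rewrite inE /=.
  move=> /FnE[trA HA]; apply/mapP.
  exists [ffun p => inord `|(entry A p + m%:Z)%R|%N]; first by rewrite mem_enum.
  apply: entry_inj; first by rewrite box_mx_trace.
  move=> p; rewrite box_mx_entry ffunE; have := HA p.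
  by move: (entry A p) => x Hx; rewrite inordK; lia.
move=> /mapP[f _ ->]; apply/FnE; split; first exact: box_mx_trace.
move=> p; rewrite box_mx_entry; have := ltn_ord (f p).
by move: (nat_of_ord (f p)) => x; lia.
Qed.

Lemma finite_Fn m : finite_set (Fn n.+1 m).
Proof. by rewrite Fn_box; apply: finite_fset. Qed.

Lemma card_Fn m : #|` fset_set (Fn n.+1 m)| = ((2 * m).+1 ^ #|free_entry n|)%N.
Proof.
rewrite Fn_box set_fsetK card_fseq undup_id; last first.
  by rewrite map_inj_uniq ?enum_uniq //; apply: box_mx_inj.
by rewrite size_map -cardE card_ffun card_ord.
Qed.

Definition slice (E : set Mat) (m : nat) : seq Mat := fset_set (E `&` Fn n.+1 m).

Lemma finite_slice (E : set Mat) m : finite_set (E `&` Fn n.+1 m).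
Proof. by apply: sub_finite_set (finite_Fn m) => x []. Qed.

Lemma uniq_slice E m : uniq (slice E m).
Proof. exact: fset_uniq. Qed.

Lemma mem_slice E m x : x \in slice E m <-> E x /\ Fn n.+1 m x.
Proof.
rewrite /slice -[_ \in _]/(x \in fset_set (E `&` Fn n.+1 m)) in_fset_set.
  by rewrite in_setE.
exact: finite_slice.
Qed.

Lemma size_slice_le E m : (size (slice E m) <= #|` fset_set (Fn n.+1 m)|)%N.
Proof.
apply: uniq_leq_size (uniq_slice E m) _ => x /mem_slice[_ Fx].
by rewrite in_fset_set ?in_setE //; apply: finite_Fn.
Qed.

Lemma corr_count (X : seq Mat) B : corr X B = count (fun x => x + B \in X) X.
Proof. by rewrite /corr -sum1_count [in RHS]big_mkcond. Qed.

Lemma corr_le_size (X : seq Mat) B : (corr X B <= size X)%N.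
Proof. by rewrite corr_count count_size. Qed.

Lemma corr_slice_le E m B :
  (corr (slice E m) B <= size (slice (E `&` set_subm E B) m))%N.
Proof.
rewrite corr_count -size_filter; apply: uniq_leq_size.
  by rewrite filter_uniq // uniq_slice.
move=> x; rewrite mem_filter => /andP[/mem_slice[EB _] /mem_slice[Ex Fx]].
by apply/mem_slice; split=> //; split=> //; exists (x + B); rewrite ?addrK.
Qed.

End TraceZeroBox.

(** * Correlations averaged against weighted lists *)

Section WeightedCorrelations.
Variables (R : realType) (n : nat).
Local Notation Mat := 'M[int]_n.+1.
Implicit Types (nu : seq Mat) (X : seq Mat).

Definition corr_avg X nu : R := (\sum_(B <- nu) (corr X B)%:R) / (size nu)%:R.

(** The uniform measure on [nu] with total mass [a], possibly negative; concatenating such lists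
    adds the measures. *)
Definition wlist (a : R) nu : seq (R * Mat) := [seq (a / (size nu)%:R, B) | B <- nu].

Lemma wlist_char a nu (chi : Mat -> R[i]) :
  \sum_(q <- wlist a nu) q.1%:C%C * chi q.2 = a%:C%C * cavg nu chi.
Proof.
rewrite big_map /= -mulr_sumr /cavg rmorphM /= fmorphV /= rmorph_nat.
by rewrite -mulrA [X in _ * X]mulrC.
Qed.

Lemma wlist_sum a nu : (0 < size nu)%N -> \sum_(q <- wlist a nu) q.1 = a.
Proof.
move=> nu0; rewrite big_map /= big_const_seq count_predT iter_addr_0.
by rewrite -[LHS]mulr_natr divfK // pnatr_eq0 -lt0n.
Qed.

Lemma wlist_corr a nu X :
  \sum_(q <- wlist a nu) q.1 * (corr X q.2)%:R = a * corr_avg X nu.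
Proof. by rewrite big_map /= -mulr_sumr /corr_avg -mulrA [X in _ * X]mulrC. Qed.

Lemma cube_trace0 L (bs : seq Mat) x : (forall b, b \in bs -> \tr b = 0) ->
  x \in cube L bs -> \tr x = 0.
Proof.
elim: bs x => [|b bs IH] x Hb /=; first by rewrite inE => /eqP ->; rewrite mxtrace0.
case/allpairsP => -[j y] /= [_ Hy ->].
rewrite mxtraceD raddfMn /= Hb ?mem_head // mul0rn add0r.
by apply: IH => // c Hc; rewrite Hb // inE Hc orbT.
Qed.

Lemma tzbase_trace (i j : 'I_n.+1) : \tr (tzbase i j) = 0.
Proof.
have tr_delta (a b : 'I_n.+1) : \tr (delta_mx a b : Mat) = (a == b)%:R.
  rewrite /mxtrace (bigD1 a) //= mxE eqxx /= big1 ?addr0 // => k ka.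
  by rewrite mxE (negPf ka).
by rewrite raddfB /= mxtraceZ !tr_delta eqxx mulr1 subrr.
Qed.

Lemma fejer_trace0 L K x : x \in fejer L (tzscaled n K) -> \tr x = 0.
Proof.
have tr0 b : b \in tzscaled n K -> \tr b = 0.
  apply: (tzscaledP (P := fun b => \tr b = 0)) => i j.
  by rewrite raddfMn /= tzbase_trace mul0rn.
case/allpairsP => -[a b] /= [Ha Hb ->].
by rewrite raddfB /= (cube_trace0 tr0 Ha) (cube_trace0 tr0 Hb) subrr.
Qed.

Definition entry_bound nu : nat := (\sum_(B <- nu) \sum_p `|entry B p|)%N.

Lemma entry_boundP nu B p : B \in nu -> (`|entry B p| <= entry_bound nu)%N.
Proof.
move=> Bnu; rewrite /entry_bound (big_rem B) //= (bigD1 p) //=.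
by rewrite -addnA leq_addr.
Qed.

Lemma slice_positivity (E : set Mat) (ps : seq (R * Mat)) (m : nat) :
  (forall q, q \in ps -> \tr q.2 = 0) -> (entry_bound (unzip2 ps) <= m)%N ->
  (forall chi : Mat -> R[i], unitary_char chi ->
     0 <= cRe (\sum_(q <- ps) q.1%:C%C * chi q.2)) ->
  (\sum_(q <- ps) q.1) * (size (slice E m))%:R ^+ 2 <=
  ((3 * m).+1 ^ #|free_entry n|)%:R * \sum_(q <- ps) q.1 * (corr (slice E m) q.2)%:R.
Proof.
move=> trps bps pos; apply: (@corr_positivity R n _ _ m) => //.
- exact: uniq_slice.
- by move=> x /mem_slice[_ /FnE].
move=> q qps; split=> [|p]; first exact: trps.
by apply: leq_trans bps; apply: entry_boundP; apply: map_f.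
Qed.

End WeightedCorrelations.

(** * Correlation densities along Fejer kernels, and the doubling argument *)

Section Recurrence.
Variables (R : realType) (n : nat) (E : set 'M[int]_n.+1).
Hypothesis n0 : (0 < n)%N.
Local Notation Mat := 'M[int]_n.+1.

Definition total (m : nat) : R := #|` fset_set (Fn n.+1 m)|%:R.

(** Zero upper density in epsilon form. *)
Definition negligible_set (F : set Mat) : Prop :=
  forall e : R, 0 < e -> exists m0 : nat, forall m, (m0 <= m)%N ->
    (size (slice F m))%:R <= e * total m.

Lemma total_gt0 m : 0 < total m.
Proof. by rewrite /total card_Fn ltr0n expn_gt0. Qed.

Definition fejer_corr (k L m : nat) : R :=
  corr_avg R (slice E m) (fejer L (tzscaled n k)) / total m.

Lemma corr_avg_le (X nu : seq Mat) (a : R) : 0 <= a ->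
  (forall B, B \in nu -> (corr X B)%:R <= a) -> corr_avg R X nu <= a.
Proof.
move=> a0 Ha; rewrite /corr_avg; case: nu Ha => [|B nu] Ha.
  by rewrite big_nil mul0r.
rewrite ler_pdivrMr ?ltr0n //.
apply: (@le_trans _ _ (\sum_(C <- B :: nu) a)).
  by rewrite big_seq [leRHS]big_seq ler_sum.
by rewrite big_const_seq count_predT iter_addr_0 mulr_natr.
Qed.

Lemma size_fejer_gt0 L k : (0 < L)%N -> (0 < size (fejer L (tzscaled n k)))%N.
Proof. by move=> L0; rewrite size_fejer !expn_gt0 L0. Qed.

Lemma fejer_corr_le1 k L m : fejer_corr k L m <= 1.
Proof.
rewrite /fejer_corr ler_pdivrMr ?total_gt0 // mul1r.
apply: corr_avg_le => [|B _]; first exact: ltW (total_gt0 m).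
by rewrite ler_nat (leq_trans (corr_le_size _ _)) // size_slice_le.
Qed.

(** Positivity applied to the Fejer kernel alone. The power of 2 compares the order of the dual
    group with the size of the box, as [3 * m + 1 <= 2 * (2 * m + 1)]. *)
Lemma fejer_corr_ge k L (c : R) : (0 < L)%N -> 0 < c -> exists m0 : nat, forall m,
  (m0 <= m)%N -> c * total m <= (size (slice E m))%:R ->
  c ^+ 2 / (2 ^ #|free_entry n|)%:R <= fejer_corr k L m.
Proof.
move=> L0 c0; set nu := fejer L (tzscaled n k).
exists (entry_bound (unzip2 (wlist (1 : R) nu))) => m lem Hc.
have := @slice_positivity R n E (wlist 1 nu) m _ lem _.
rewrite wlist_sum ?size_fejer_gt0 // wlist_corr !mul1r => H.
have {H} : (size (slice E m))%:R ^+ 2 <=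
   ((3 * m).+1 ^ #|free_entry n|)%:R * corr_avg R (slice E m) nu.
  apply: H => [_ /mapP[B Bnu ->]|chi chiP]; first exact: fejer_trace0 Bnu.
  by rewrite wlist_char mul1r fejer_ge0.
have t0 := total_gt0 m.
have : ((3 * m).+1 ^ #|free_entry n|)%:R <= (2 ^ #|free_entry n|)%:R * total m :> R.
  rewrite /total card_Fn -natrM ler_nat -expnMn.
  by case: #|_| => // q; rewrite leq_exp2r //; lia.
have : 0 <= corr_avg R (slice E m) nu.
  by rewrite /corr_avg divr_ge0 // sumr_ge0.
rewrite /fejer_corr -/nu; set x := corr_avg _ _ _ => x0 HM Hx.
have P0 : 0 < (2 ^ #|free_entry n|)%:R :> R by rewrite ltr0n expn_gt0.
rewrite ler_pdivrMr // mulrAC ler_pdivlMr //.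
have h1 : (c * total m) ^+ 2 <= (size (slice E m))%:R ^+ 2.
  by rewrite lerXn2r ?nnegrE ?mulr_ge0 // ltW.
have h2 := le_trans h1 (le_trans Hx (ler_wpM2r x0 HM)).
rewrite -(ler_pM2r t0); move: h2; rewrite exprMn; lra.
Qed.

(** The key inequality gives [2 * x <= y + 5 * e] for the correlations [x] at [k] and [y] at [K]:
    [e] from the negligible return sets and [4 * e] from the constant term. Subtracting [5 * e] on
    both levels makes this an exact doubling. *)
Lemma fejer_corr_step (e : R) k A : 0 < e -> e <= 1 -> (0 < k)%N ->
  kMd0 n.+1 k A -> A != 0 ->
  (forall g, \det g = 1 ->
     negligible_set (E `&` set_subm E (g *m A *m invmx g))) ->
  exists2 K, (0 < K)%N & forall L, (0 < L)%N ->
  exists2 L', (0 < L')%N & exists m0 : nat, forall m, (m0 <= m)%N ->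
    2 * (fejer_corr k L' m - 5 * e) <= fejer_corr K L m - 5 * e.
Proof.
move=> e0 e1 k0 [trA dvA] A0 negl.
have [K K0 HK] := key_inequality n0 e0 e1 k0 trA dvA A0.
exists K => // L L0; have [L' L'0 [nu [nu0 nuP pos]]] := HK L L0.
exists L' => //.
(* The signed measure behind the key inequality; the constant [4 * e] is a point mass at 0. *)
pose ps : seq (R * Mat) := wlist 1 nu ++ wlist (4 * e) [:: 0]
   ++ wlist 1 (fejer L (tzscaled n K)) ++ wlist (- 2) (fejer L' (tzscaled n k)).
have [m1 Hm1] : exists m1 : nat, forall m, (m1 <= m)%N -> forall B, B \in nu ->
    (size (slice (E `&` set_subm E B) m))%:R <= e * total m.
  have : forall B, B \in nu -> negligible_set (E `&` set_subm E B).
    by move=> B /nuP[g detg <-]; apply: negl.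
  elim: (nu) => [_|B s IH Hs]; first by exists 0%N.
  have [a Ha] := Hs B (mem_head _ _) e e0.
  have [b Hb] : exists m1 : nat, forall m, (m1 <= m)%N -> forall B, B \in s ->
    (size (slice (E `&` set_subm E B) m))%:R <= e * total m.
    by apply: IH => C Cs; apply: Hs; rewrite inE Cs orbT.
  exists (a + b)%N => m lem C; rewrite inE => /orP[/eqP ->|Cs].
    by apply: Ha; lia.
  by apply: Hb => //; lia.
exists (m1 + entry_bound (unzip2 ps))%N => m lem.
have lt0 := total_gt0 m.
have := @slice_positivity R n E ps m _ _ _.
have -> : \sum_(q <- ps) q.1 = 4 * e.
  by rewrite /ps !big_cat /= !wlist_sum ?size_fejer_gt0 //; lra.
have -> : \sum_(q <- ps) q.1 * (corr (slice E m) q.2)%:R =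
   corr_avg R (slice E m) nu + 4 * e * corr_avg R (slice E m) [:: 0]
   + corr_avg R (slice E m) (fejer L (tzscaled n K))
   - 2 * corr_avg R (slice E m) (fejer L' (tzscaled n k)).
  by rewrite /ps !big_cat /= !wlist_corr; lra.
move=> H; have {H} := H _ _ _.
have /[swap] /[apply] : forall q, q \in ps -> \tr q.2 = 0.
  move=> q; rewrite !mem_cat => /or4P[] /mapP[B HB ->] /=.
  - have [g detg <-] := nuP B HB.
    by have [] := conj_trace_dvd detg trA dvA.
  - by move: HB; rewrite inE => /eqP ->; rewrite mxtrace0.
  - exact: fejer_trace0 HB.
  - exact: fejer_trace0 HB.
have /[swap] /[apply] : (entry_bound (unzip2 ps) <= m)%N by lia.
have /[swap] /[apply] : forall chi : Mat -> R[i], unitary_char chi ->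
    0 <= cRe (\sum_(q <- ps) q.1%:C%C * chi q.2).
  move=> chi chiP; rewrite /ps !big_cat /= !wlist_char !cReD !cReMl.
  have -> : cavg [:: 0] chi = 1.
    by rewrite /cavg big_seq1 divr1 (char0 chiP).
  by have := pos chi chiP; rewrite (_ : cRe 1 = 1) //; lra.
have : corr_avg R (slice E m) nu <= e * total m.
  apply: corr_avg_le => [|B Bnu]; first by rewrite mulr_ge0 // ltW.
  apply: le_trans (Hm1 m _ B Bnu); last by lia.
  by rewrite ler_nat corr_slice_le.
have : corr_avg R (slice E m) [:: 0] <= total m.
  apply: corr_avg_le => [|B _]; first exact: ltW.
  by rewrite ler_nat (leq_trans (corr_le_size _ _)) // size_slice_le.
rewrite /fejer_corr.
set x0 := corr_avg _ _ [:: 0]; set xn := corr_avg _ _ nu.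
set xK := corr_avg _ _ _; set xk := corr_avg _ _ _; set t := total m.
move=> Hx0 Hxn Hpos.
have P0 : 0 < ((3 * m).+1 ^ #|free_entry n|)%:R :> R by rewrite ltr0n expn_gt0.
have : 0 <= xn + 4 * e * x0 + xK - 2 * xk.
  rewrite -(pmulr_rge0 _ P0); apply: le_trans Hpos.
  by rewrite !mulr_ge0 ?sqr_ge0 // ltW.
have : e * x0 <= e * t by rewrite ler_wpM2l // ltW.
move=> h1 h2.
have tE (y : R) : y / t * t = y by rewrite divfK // gt_eqF.
have := tE xk; have := tE xK; rewrite -(ler_pM2r lt0) -/t.
by move: (xk / t) (xK / t) => a b Ha Hb; lra.
Qed.

Lemma recurrence (c : R) : 0 < c ->
  (forall m0 : nat, exists2 m, (m0 <= m)%N &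
     c * total m <= (size (slice E m))%:R) ->
  exists2 k : nat, (0 < k)%N & forall A, kMd0 n.+1 k A ->
  exists2 g, \det g = 1 &
    ~ negligible_set (E `&` set_subm E (g *m A *m invmx g)).
Proof.
move=> c0 Hc; apply: contrapT => nok.
have bad k : (0 < k)%N -> exists2 A, kMd0 n.+1 k A & forall g, \det g = 1 ->
    negligible_set (E `&` set_subm E (g *m A *m invmx g)).
  move=> k0; apply: contrapT => noA; apply: nok; exists k => // A kA.
  apply: contrapT => nog; apply: noA; exists A => // g detg.
  by apply: contrapT => Hn; apply: nog; exists g.
(* For [A = 0] the return set is [E] itself, which is not negligible. *)
have bad0 k A : (0 < k)%N -> kMd0 n.+1 k A -> (forall g, \det g = 1 ->
    negligible_set (E `&` set_subm E (g *m A *m invmx g))) -> A != 0.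
  move=> k0 kA /(_ 1%:M (det1 _ _)) Hn; apply/eqP => A0.
  move: Hn; rewrite A0 mulmx0 mul0mx => Hn.
  have [m0 Hm0] := Hn (c / 2) (divr_gt0 c0 (ltr0n _ 2)).
  have [m lem Hm] := Hc m0; have := Hm0 m lem.
  have -> : E `&` set_subm E 0 = E.
    apply/seteqP; split=> [x []//|x Ex]; split=> //.
    by exists x; rewrite ?subr0.
  by have := total_gt0 m => t0 Hm'; have := mulr_gt0 c0 t0; lra.
pose c1 : R := c ^+ 2 / (2 ^ #|free_entry n|)%:R.
have c10 : 0 < c1 by rewrite divr_gt0 ?exprn_gt0 // ltr0n expn_gt0.
(* With this choice [5 * e] is at most half of the lower bound [c1]. *)
pose e : R := Num.min 1 (c1 / 10).
have e0 : 0 < e by rewrite lt_min ltr01 divr_gt0.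
have e1 : e <= 1 by rewrite ge_min lexx.
have ec : e <= c1 / 10 by rewrite ge_min lexx orbT.
(* The induction needs all [k] at once: the multiple [K] supplied by the step at [k] is fed to the
   hypothesis, and the [L] found there determines the side for [k]. *)
have iter J : forall k, (0 < k)%N -> exists2 L, (0 < L)%N & exists m0 : nat,
    forall m, (m0 <= m)%N -> 2 ^+ J * (fejer_corr k L m - 5 * e) <= 1.
  elim: J => [|J IH] k k0.
    exists 1%N => //; exists 0%N => m _; rewrite expr0 mul1r.
    by have := fejer_corr_le1 k 1 m; lra.
  have [A kA Hn] := bad k k0; have A0 := bad0 k A k0 kA Hn.
  have [K K0 HK] := fejer_corr_step e0 e1 k0 kA A0 Hn.
  have [L L0 [m1 Hm1]] := IH K K0; have [L' L'0 [m2 Hm2]] := HK L L0.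
  exists L' => //; exists (m1 + m2)%N => m lem.
  rewrite exprSr -mulrA.
  apply: le_trans (Hm1 m _); last by lia.
  by rewrite ler_wpM2l ?exprn_ge0 //; apply: Hm2; lia.
(* Then [J * (c1 / 2)] is at least 2, so [2 ^+ J] times the excess at [k = 1] exceeds 1. *)
have [J J0 HJ] := nat_above (4 / c1).
have [L L0 [m1 Hm1]] := iter J 1%N isT.
have [m2 Hm2] := fejer_corr_ge 1 L0 c0.
have [m lem Hm] := Hc (m1 + m2)%N.
have h1 := Hm1 m (leq_trans (leq_addr _ _) lem).
have h2 : c1 <= fejer_corr 1 L m := Hm2 m (leq_trans (leq_addl _ _) lem) Hm.
have h3 : 4 <= J%:R * c1 by move: HJ; rewrite ler_pdivrMr.
have h4 : J%:R <= 2 ^+ J :> R by rewrite -natrX ler_nat ltnW // ltn_expl.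
have h5 : J%:R * (c1 / 2) <= 2 ^+ J * (fejer_corr 1 L m - 5 * e).
  apply: ler_pM => //; first by rewrite divr_ge0 // ltW.
  by clearbody c1 e; lra.
by clearbody c1 e; lra.
Qed.

End Recurrence.

(** * From upper densities to statements about slices, and conclusion *)

Lemma limn_esup_inf (R : realType) (u : (\bar R)^nat) :
  limn_esup u = ereal_inf (range (esups u)).
Proof. by rewrite limn_esup_lim; apply/cvg_lim => //; apply: cvg_esups_inf. Qed.

(** Every tail supremum exceeds any [c] strictly below the upper limit. *)
Lemma limn_esup_gt0 (R : realType) (u : R^nat) :
  (0 < limn_esup (fun m => (u m)%:E))%E ->
  exists2 c : R, 0 < c & forall m0 : nat, exists2 m, (m0 <= m)%N & c <= u m.
Proof.
rewrite limn_esup_inf; set l := ereal_inf _ => l0.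
have [c c0 cl] : exists2 c : R, 0 < c & (c%:E < l)%E.
  case: l l0 => [x| |] // x0; last by exists 1; rewrite ?ltr01 ?ltry.
  by exists (x / 2); move: x0; rewrite ?lte_fin; lra.
exists c => // m0; have : (c%:E < esups (fun m => (u m)%:E) m0)%E.
  by apply: lt_le_trans cl _; apply: ereal_inf_lbound; exists m0.
move=> /ereal_sup_gt[_ [m /= lem <-]]; rewrite lte_fin => cm.
by exists m => //; exact: ltW.
Qed.

Lemma limn_esup_le0 (R : realType) (u : R^nat) :
  ~ (0 < limn_esup (fun m => (u m)%:E))%E ->
  forall e : R, 0 < e -> exists m0 : nat, forall m, (m0 <= m)%N -> u m <= e.
Proof.
move=> /negP; rewrite -leNgt limn_esup_inf => l0 e e0.
have /ereal_inf_lt[_ [m0 _ <-] He] : (ereal_inf (range (esups (fun m => (u m)%:E))) < e%:E)%E.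
  by apply: le_lt_trans l0 _; rewrite lte_fin.
exists m0 => m lem; rewrite -lee_fin; apply: le_trans (ltW He).
by apply: ereal_sup_ubound; exists m.
Qed.

Theorem theorem1p5 (d : nat) (E : set 'M[int]_d) :
  (2 <= d)%N ->
  E `<=` Md0 d ->
  (0 < upper_density E)%E ->
  exists k : nat, (1 <= k)%N /\
    forall A : 'M[int]_d, kMd0 d k A ->
      exists g : 'M[int]_d, \det g = 1 /\
        (0 < upper_density (E `&` set_subm E (g *m A *m invmx g)))%E.
Proof.
(* With [d = n.+1], the bound [2 <= d] is the condition [0 < n] of the preceding sections. *)
case: d E => // n E n0 _ /limn_esup_gt0[c c0 Hc].
have ratioE (F : set 'M[int]_n.+1) m :
    dens_ratio F m = (size (slice F m))%:R / total Rdefinitions.R n m by [].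
have [|k k0 Hk] := @recurrence Rdefinitions.R n E n0 c c0.
  move=> m0; have [m lem Hm] := Hc m0; exists m => //.
  by move: Hm; rewrite ratioE ler_pdivlMr ?total_gt0.
exists k; split=> // A kA; have [g detg Hg] := Hk A kA.
exists g; split=> //; apply: contrapT => Hn; apply: Hg => e e0.
have [m0 Hm0] := limn_esup_le0 Hn e0; exists m0 => m lem.
by have := Hm0 m lem; rewrite ratioE ler_pdivrMr ?total_gt0.
Qed.
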